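(* There is a universal constant $C>0$ such that the following holds. Let $d,m\in\mathbb{N}$, and let $\Sigma$ and $\Omega$ be real symmetric positive definite matrices of sizes $d\times d$ and $m\times m$, respectively. Let $X\sim T_{d,m}(\nu,\Sigma,\Omega)$ (centered matrix-variate $T$ distribution) and $Y\sim\mathrm{MN}_{d,m}(0_{d\times m},\Sigma\otimes\Omega)$ (centered matrix-variate normal distribution), and let $\mathbb{P}_{\nu,\Sigma,\Omega}$ and $\mathbb{Q}_{\Sigma,\Omega}$ be the laws of $X$ and $Y\sqrt{\nu/(\nu-2)}$, respectively. Then, as $\nu\to\infty$ (i.e. for all sufficiently large $\nu$), $$\mathrm{dist}(\mathbb{P}_{\nu,\Sigma,\Omega},\mathbb{Q}_{\Sigma,\Omega})\le\frac{C\,(md)^{3/2}}{\nu}\qquad\text{and}\qquad\mathcal{H}(\mathbb{P}_{\nu,\Sigma,\Omega},\mathbb{Q}_{\Sigma,\Omega})\le\sqrt{\frac{2C\,(md)^{3/2}}{\nu}},$$ where $\mathcal{H}(\cdot,\cdot)$ denotes the Hellinger distance, and $\mathrm{dist}(\cdot,\cdot)$ can be replaced by any of the following probability metrics: total variation, Kolmogorov (or uniform) metric, Lévy metric, discrepancy metric, Prokhorov metric.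
   Context: $|\cdot|$ denotes the determinant and $\mathrm{tr}$ the trace. For $\nu>0$, $T_{d,m}(\nu,\Sigma,\Omega)$ is the distribution on $\mathbb{R}^{d\times m}$ with density $$K_{\nu,\Sigma,\Omega}(X) := \frac{\Gamma_d(\frac12(\nu+m+d-1))}{\Gamma_d(\frac12(\nu+d-1))}\,\frac{|\mathrm{I}_d+\nu^{-1}\Sigma^{-1}X\Omega^{-1}X^{\top}|^{-(\nu+m+d-1)/2}}{(\nu\pi)^{md/2}|\Sigma|^{m/2}|\Omega|^{d/2}},$$ where $\Gamma_d(z)=\pi^{d(d-1)/4}\prod_{j=1}^d\Gamma\big(z-\frac{j-1}{2}\big)$, $\Re(z)>\frac{d-1}{2}$, is the multivariate gamma function. $\mathrm{MN}_{d,m}(0_{d\times m},\Sigma\otimes\Omega)$ is the distribution on $\mathbb{R}^{d\times m}$ with density $$g_{\Sigma,\Omega}(X)=\frac{\exp\big(-\frac12\mathrm{tr}(\Sigma^{-1}X\Omega^{-1}X^{\top})\big)}{(2\pi)^{md/2}|\Sigma|^{m/2}|\Omega|^{d/2}}.$$ The constant $C$ does not depend on $d,m,\Sigma,\Omega,\nu$; the threshold beyond which $\nu$ is ''sufficiently large'' may depend on $d,m,\Sigma,\Omega$. Standard metrics between probability measures $P,Q$ on $\mathbb{R}^{d\times m}\cong\mathbb{R}^{dm}$ (with Euclidean norm), with distribution functions $F,G$ and densities $p,q$: total variation $\sup_A|P(A)-Q(A)|$ over Borel sets $A$; Kolmogorov $\sup_x|F(x)-G(x)|$; Lévy $\inf\{\varepsilon>0: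 F(x-\varepsilon\mathbf{1})-\varepsilon\le G(x)\le F(x+\varepsilon\mathbf{1})+\varepsilon\ \forall x\}$, where $\mathbf{1}$ is the all-ones vector; discrepancy $\sup_B|P(B)-Q(B)|$ over closed balls $B$; Prokhorov $\inf\{\varepsilon>0: P(A)\le Q(A^{\varepsilon})+\varepsilon\ \text{for all Borel } A\}$, where $A^{\varepsilon}=\{x:\inf_{y\in A}\|x-y\|\le\varepsilon\}$; Hellinger $\mathcal{H}(P,Q)=\big(\int(\sqrt p-\sqrt q)^2\big)^{1/2}$. *)

(* Defs.v *)
From HB Require Import structures.
From mathcomp Require Import all_boot all_order all_algebra.
From mathcomp Require Import all_classical all_reals all_analysis.
From mathcomp Require Import measurable_realfun.

Set Implicit Arguments.
Unset Strict Implicit.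
Unset Printing Implicit Defensive.

Import Order.TTheory GRing.Theory Num.Theory.
Import numFieldNormedType.Exports.

Local Open Scope classical_set_scope.
Local Open Scope ring_scope.

Definition borel_mx_display : measure_display.
Proof. exact: default_measure_display. Qed.

Section borel_mx.
Context (R : realType) (m n : nat).

Definition borel_mx : set (set 'M[R]_(m, n)) := <<s open >>.

Let borel_mx0 : borel_mx set0.
Proof. exact: sigma_algebra0. Qed.

Let borel_mxC A : borel_mx A -> borel_mx (~` A).
Proof. exact: sigma_algebraC. Qed.

Let borel_mx_bigcup (F : (set 'M[R]_(m, n))^nat) :
  (forall i, borel_mx (F i)) -> borel_mx (\bigcup_i F i).
Proof. exact: sigma_algebra_bigcup. Qed.

HB.instance Definition _ := @isMeasurable.Build borel_mx_display
  'M[R]_(m, n) borel_mx borel_mx0 borel_mxC borel_mx_bigcup.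

End borel_mx.

Section measurable_mx.
Context (R : realType) (m n : nat).

Lemma measurable_coord (i : 'I_m) (j : 'I_n) :
  measurable_fun [set: 'M[R]_(m, n)] (fun M : 'M[R]_(m, n) => M i j).
Proof.
apply: (measurability _ (RGenOpens.measurableE R)).
move=> _ [_ [a [b ->]] <-]; rewrite setTI.
apply: sub_sigma_algebra; apply: open_comp; last exact: interval_open.
by move=> x _; exact: coord_continuous.
Qed.

Let rbox (qk : 'M[rat]_(m, n) * nat) : set 'M[R]_(m, n) :=
  [set M | forall i j, `|M i j - ratr (qk.1 i j)| < qk.2.+1%:R^-1].

Let open_rbox (U : set 'M[R]_(m, n)) : open U ->
  U = \bigcup_(qk in [set qk | rbox qk `<=` U]) rbox qk.
Proof.
move=> oU; apply/seteqP; split=> [M UM|M [qk /= + ?]]; last exact.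
have [e /= e0 eU] : nbhs_ball M U.
  by apply/nbhs_ballP; exact: open_nbhs_nbhs.
have [k ke] : exists k : nat, k.+1%:R^-1 < e / 2.
  have [k] := ltr_add_invr (divr_gt0 e0 (ltr0Sn R 1)).
  by rewrite add0r => kE; exists k.
have k0 : 0 < k.+1%:R^-1 :> R by rewrite invr_gt0.
have qP ij : exists q : rat, `|M ij.1 ij.2 - ratr q| < k.+1%:R^-1.
  have /rat_in_itvoo[q] : M ij.1 ij.2 - k.+1%:R^-1 < M ij.1 ij.2 + k.+1%:R^-1.
    by rewrite ltrD2l (lt_trans _ k0)// oppr_lt0.
  rewrite in_itv/= => /andP[q1 q2]; exists q.
  by rewrite distrC ltr_distl q1 q2.
have [q {}qP] := choice qP.
exists (\matrix_(i, j) q (i, j), k) => /=; last first.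
  by move=> i j /=; rewrite mxE; exact: (qP (i, j)).
move=> N /= qN; apply: eU; split => // i j.
have := qN i j; rewrite /= mxE => qNij.
rewrite -ball_normE /=.
rewrite (le_lt_trans (ler_distD (ratr (q (i, j))) _ _))//.
rewrite (splitr e) ltrD//; first exact: lt_trans (qP (i, j)) ke.
by rewrite distrC (lt_trans qNij).
Qed.

Lemma measurable_fun_mxP d (T : measurableType d) (f : T -> 'M[R]_(m, n)) :
  measurable_fun [set: T] f <->
  forall i j, measurable_fun [set: T] (fun t => f t i j).
Proof.
split=> [mf i j|mf].
  exact: (measurableT_comp (measurable_coord i j)).
have mxE : @measurable _ 'M[R]_(m, n) = <<s open >> by [].
apply: (measurability _ mxE).
move=> _ [U oU <-]; rewrite setTI (open_rbox oU) preimage_bigcup bigcup_mkcond.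
apply: countable_bigcupT_measurable => [|qk]; first exact: countableP.
case: ifP => _ //.
rewrite (_ : _ @^-1` _ = \bigcap_(ij in [set: 'I_m * 'I_n])
    ((fun t => f t ij.1 ij.2) @^-1`
      ball (ratr (qk.1 ij.1 ij.2) : R) qk.2.+1%:R^-1)).
  apply: fin_bigcap_measurable => //= -[i j] _.
  rewrite -[X in measurable X]setTI; apply: mf => //.
  exact: measurable_ball.
apply/seteqP; split=> [t ft [i j] _ /=|t ft i j].
  by rewrite -ball_normE /= distrC; exact: ft.
by have := ft (i, j) I; rewrite /= -ball_normE /= distrC.
Qed.

End measurable_mx.

Section lebesgue_tuple.
Context (R : realType).

Definition tuple_cons n (p : R * n.-tuple R) : n.+1.-tuple R :=
  [tuple of p.1 :: p.2].

Let measurable_tuple_cons n :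
  measurable_fun [set: R * n.-tuple R] (@tuple_cons n).
Proof. exact: measurable_cons. Qed.

HB.instance Definition _ n :=
  isMeasurableFun.Build _ _ _ _ (@tuple_cons n) (@measurable_tuple_cons n).

Section cons.
Context (n : nat) (mu : {sigma_finite_measure set (n.-tuple R) -> \bar R}).

Definition lebesgue_cons : set (n.+1.-tuple R) -> \bar R :=
  pushforward (lebesgue_measure \x mu)%E (@tuple_cons n).

Let lebesgue_cons0 : lebesgue_cons set0 = 0%E.
Proof. by rewrite /lebesgue_cons /pushforward preimage_set0 measure0. Qed.

Let lebesgue_cons_ge0 A : (0 <= lebesgue_cons A)%E.
Proof. by rewrite /lebesgue_cons /pushforward; exact: measure_ge0. Qed.

Let lebesgue_cons_sigma_additive : semi_sigma_additive lebesgue_cons.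
Proof.
by apply: measure_semi_sigma_additive; exact: measurable_tuple_cons.
Qed.

HB.instance Definition _ := isMeasure.Build _ _ _ lebesgue_cons
  lebesgue_cons0 lebesgue_cons_ge0 lebesgue_cons_sigma_additive.

Let lebesgue_cons_sigma_finite : sigma_finite setT lebesgue_cons.
Proof.
have /sigma_finiteP[F [TF ndF Foo]] := sigma_finiteT (@lebesgue_measure R).
have /sigma_finiteP[G [TG ndG Goo]] := sigma_finiteT mu.
pose g (t : n.+1.-tuple R) := (thead t, [tuple of behead t]).
have mg : measurable_fun [set: n.+1.-tuple R] g.
  apply: measurable_fun_pair; last exact: measurable_behead.
  exact: measurable_tnth.
have consK : cancel (@tuple_cons n) g.
  by move=> [x t]; congr pair; apply/val_inj.
exists (fun k => g @^-1` (F k `*` G k)).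
  rewrite -preimage_bigcup -[LHS](preimage_setT g); congr (_ @^-1` _).
  rewrite -setXTT TF TG; apply/seteqP; split=> -[x t] /=.
    move=> [[k _ Fkx] [l _ Glt]]; exists (maxn k l) => //; split.
    - by move: x Fkx; exact/subsetPset/ndF/leq_maxl.
    - by move: t Glt; exact/subsetPset/ndG/leq_maxr.
  by move=> [k _ [? ?]]; split; exists k.
move=> k; have [mFk Fkoo] := Foo k; have [mGk Gkoo] := Goo k; split.
  by rewrite -[X in measurable X]setTI; apply: mg => //; exact: measurableX.
rewrite /lebesgue_cons /pushforward -comp_preimage.
rewrite (_ : g \o _ = id) ?preimage_id; last first.
  by apply/funext => p /=; rewrite consK.
by rewrite product_measure1E// lte_mul_pinfty// ge0_fin_numE.
Qed.

HB.instance Definition _ := Measure_isSigmaFinite.Build _ _ _ lebesgue_cons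
  lebesgue_cons_sigma_finite.

End cons.

Fixpoint lebesgue_tuple n : {sigma_finite_measure set (n.-tuple R) -> \bar R} :=
  match n with
  | 0 => \d_[tuple]
  | k.+1 => lebesgue_cons (lebesgue_tuple k)
  end.

End lebesgue_tuple.

Section lebesgue_mx.
Context (R : realType) (m n : nat).

Definition mx_of_tuple (t : (m * n).-tuple R) : 'M[R]_(m, n) :=
  \matrix_(i, j) tnth t (mxvec_index i j).

Lemma measurable_mx_of_tuple :
  measurable_fun [set: (m * n).-tuple R] mx_of_tuple.
Proof.
apply/measurable_fun_mxP => i j.
rewrite (_ : (fun t => _) = (@tnth _ R)^~ (mxvec_index i j)).
  exact: measurable_tnth.
by apply/funext => t; rewrite mxE.
Qed.

HB.instance Definition _ :=
  isMeasurableFun.Build _ _ _ _ mx_of_tuple measurable_mx_of_tuple.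

(* Lebesgue measure on 'M[R]_(m, n), identified with R ^ (m * n) entrywise. *)
Definition lebesgue_mx : set 'M[R]_(m, n) -> \bar R :=
  pushforward (lebesgue_tuple R (m * n)) mx_of_tuple.

Let lebesgue_mx0 : lebesgue_mx set0 = 0%E.
Proof. by rewrite /lebesgue_mx /pushforward preimage_set0 measure0. Qed.

Let lebesgue_mx_ge0 A : (0 <= lebesgue_mx A)%E.
Proof. by rewrite /lebesgue_mx /pushforward; exact: measure_ge0. Qed.

Let lebesgue_mx_sigma_additive : semi_sigma_additive lebesgue_mx.
Proof.
by apply: measure_semi_sigma_additive; exact: measurable_mx_of_tuple.
Qed.

HB.instance Definition _ := isMeasure.Build _ _ _ lebesgue_mx
  lebesgue_mx0 lebesgue_mx_ge0 lebesgue_mx_sigma_additive.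

Let lebesgue_mx_sigma_finite : sigma_finite setT lebesgue_mx.
Proof.
have [F FT mF] := sigma_finiteT (lebesgue_tuple R (m * n)).
pose g (M : 'M[R]_(m, n)) := [tuple mxvec M ord0 k | k < m * n].
have mg : measurable_fun [set: 'M[R]_(m, n)] g.
  apply/measurable_fun_tnthP => k.
  have [i j] := mxvec_indexP k.
  rewrite (_ : _ \o _ = fun M : 'M[R]_(m, n) => M i j).
    exact: measurable_coord.
  by apply/funext => M /=; rewrite tnth_mktuple mxvecE.
have gK : cancel mx_of_tuple g.
  move=> t; apply: eq_from_tnth => k; rewrite tnth_mktuple.
  by have [i j] := mxvec_indexP k; rewrite mxvecE mxE.
exists (fun k => g @^-1` F k).
  by rewrite -preimage_bigcup -FT preimage_setT.
move=> k; have [mFk Fkoo] := mF k; split.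
  by rewrite -[X in measurable X]setTI; exact: mg.
rewrite /lebesgue_mx /pushforward -comp_preimage.
rewrite (_ : g \o _ = id) ?preimage_id//.
by apply/funext => t /=; rewrite gK.
Qed.

HB.instance Definition _ := Measure_isSigmaFinite.Build _ _ _ lebesgue_mx
  lebesgue_mx_sigma_finite.

End lebesgue_mx.

Lemma lebesgue_tuple_box (R : realType) n (A : 'I_n -> set R) :
  (forall i, measurable (A i)) ->
  lebesgue_tuple R n [set t | forall i, A i (tnth t i)] =
  (\prod_(i < n) lebesgue_measure (A i))%E.
Proof.
elim: n A => [|n IH] A mA.
  by rewrite big_ord0 /= diracE mem_set//; case.
rewrite big_ord_recl -(IH (A \o lift ord0)); last by move=> i; exact: mA.
rewrite /= /lebesgue_cons /pushforward -product_measure1E; [|exact: mA|]; last first.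
  rewrite (_ : mkset _ = \bigcap_(i in [set: 'I_n])
    (@tnth n R ^~ i @^-1` A (lift ord0 i))).
    apply: fin_bigcap_measurable => // i _.
    by rewrite -[X in measurable X]setTI; apply: measurable_tnth.
  by apply/seteqP; split=> t /= At i; [move=> _; exact: At|exact: (At i)].
congr (product_measure1 _ _ _); apply/seteqP; split=> -[x t] /= At.
  split; first exact: (At ord0).
  by move=> i; have := At (lift ord0 i); rewrite tnthS.
move=> i; case: (unliftP ord0 i) => [j ->|->]; last exact: At.1.
by rewrite tnthS; exact: At.2.
Qed.

Lemma lebesgue_mx_box (R : realType) m n (A : 'I_m -> 'I_n -> set R) :
  (forall i j, measurable (A i j)) ->
  lebesgue_mx [set M : 'M[R]_(m, n) | forall i j, A i j (M i j)] =
  (\prod_(i < m) \prod_(j < n) lebesgue_measure (A i j))%E.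
Proof.
move=> mA; rewrite pair_bigA /=.
have [g fK' gK'] := curry_mxvec_bij m n.
have gK k : mxvec_index (g k).1 (g k).2 = k.
  by have := gK' k isT; case: (g k).
have fK i j : g (mxvec_index i j) = (i, j) by exact: (fK' (i, j) isT).
pose B k := A (g k).1 (g k).2.
have mB k : measurable (B k) by exact: mA.
rewrite (reindex g) /=; last first.
  by exists (fun ij => mxvec_index ij.1 ij.2) => [k _|[i j] _] /=.
rewrite -(lebesgue_tuple_box mB).
rewrite /lebesgue_mx /pushforward; congr (lebesgue_tuple R _ _).
apply/seteqP; split=> t /= At.
  by move=> k; have := At (g k).1 (g k).2; rewrite mxE gK.
move=> i j; rewrite mxE; have := At (mxvec_index i j).
by rewrite /B fK.
Qed.

Section scale_mx.
Context d (T : measurableType d) (R : realType) (m n : nat).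

Definition scale_mx (c : R) (X : T -> 'M[R]_(m, n)) : T -> 'M[R]_(m, n) :=
  fun t => c *: X t.

Lemma measurable_scale_mx (c : R) (X : {mfun T >-> 'M[R]_(m, n)}) :
  measurable_fun [set: T] (scale_mx c X).
Proof.
apply/measurable_fun_mxP => i j.
rewrite (_ : (fun t => _) = (fun t => c * X t i j)).
  apply: measurable_funM => //.
  exact: (measurable_fun_mxP _).1 (measurable_funPT X) i j.
by apply/funext => t; rewrite mxE.
Qed.

HB.instance Definition _ (c : R) (X : {mfun T >-> 'M[R]_(m, n)}) :=
  isMeasurableFun.Build _ _ _ _ (scale_mx c X) (measurable_scale_mx c X).

End scale_mx.

Section matrix_distributions.
Context {R : realType}.

Definition posdefmx n (A : 'M[R]_n) : Prop :=
  A^T = A /\ forall v : 'cV[R]_n, v != 0 -> 0 < (v^T *m A *m v) 0 0.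

(* Only meant for z > 0, where the integral converges. *)
Definition gamma_fun (z : R) : R :=
  \int[lebesgue_measure]_(t in `]0, +oo[) (t `^ (z - 1) * expR (- t)).

Definition mgamma_fun (d : nat) (z : R) : R :=
  pi `^ ((d * d.-1)%:R / 4) *
  \prod_(1 <= j < d.+1) gamma_fun (z - (j%:R - 1) / 2).

Section densities.
Context {d m : nat}.

Definition matrixT_density (nu : R) (Sigma : 'M[R]_d) (Omega : 'M[R]_m)
    (X : 'M[R]_(d, m)) : R :=
  mgamma_fun d ((nu + m%:R + d%:R - 1) / 2) /
    mgamma_fun d ((nu + d%:R - 1) / 2) *
  (\det (1%:M + nu^-1 *: (invmx Sigma *m X *m invmx Omega *m X^T))
      `^ (- ((nu + m%:R + d%:R - 1) / 2)) /
    ((nu * pi) `^ ((m * d)%:R / 2) *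
     \det Sigma `^ (m%:R / 2) * \det Omega `^ (d%:R / 2))).

Definition matrix_normal_density (Sigma : 'M[R]_d) (Omega : 'M[R]_m)
    (X : 'M[R]_(d, m)) : R :=
  expR (- (2^-1 * \tr (invmx Sigma *m X *m invmx Omega *m X^T))) /
    ((2 * pi) `^ ((m * d)%:R / 2) *
     \det Sigma `^ (m%:R / 2) * \det Omega `^ (d%:R / 2)).

Definition has_density (P : set 'M[R]_(d, m) -> \bar R)
    (p : 'M[R]_(d, m) -> R) : Prop :=
  [/\ measurable_fun [set: 'M[R]_(d, m)] p,
      forall x, 0 <= p x &
      forall A, measurable A ->
        P A = (\int[@lebesgue_mx R d m]_(x in A) (p x)%:E)%E].

End densities.
End matrix_distributions.

Section probability_metrics.
Context {R : realType} {d m : nat}.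
Local Notation M := 'M[R]_(d, m).
Implicit Types P Q : probability M R.
Local Open Scope ereal_scope.

(* The library norm on matrices is the max norm. *)
Definition norm2_mx (x : M) : R :=
  Num.sqrt (\sum_(i < d) \sum_(j < m) x i j ^+ 2)%R.

Definition cdf_mx P (x : M) : \bar R :=
  P [set y : M | forall i j, (y i j <= x i j)%R].

Definition total_variation_dist P Q : \bar R :=
  ereal_sup [set `|P A - Q A| | A in measurable].

Definition kolmogorov_dist P Q : \bar R :=
  ereal_sup [set `|cdf_mx P x - cdf_mx Q x| | x in [set: M]].

Definition levy_dist P Q : \bar R :=
  ereal_inf [set e%:E | e in [set e : R | (0 < e)%R /\ forall x : M,
    cdf_mx P (x - const_mx e)%R - e%:E <= cdf_mx Q x /\
    cdf_mx Q x <= cdf_mx P (x + const_mx e)%R + e%:E]].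

Definition closed_ball2 (x : M) (r : R) : set M :=
  [set y | (norm2_mx (y - x)%R <= r)%R].

Definition discrepancy_dist P Q : \bar R :=
  ereal_sup [set `|P B - Q B| | B in
    [set B | exists (x : M) (r : R), (0 < r)%R /\ B = closed_ball2 x r]].

(* The infimum is taken in \bar R, so that the enlargement of set0 is set0. *)
Definition enlarge (A : set M) (e : R) : set M :=
  [set x | ereal_inf [set (norm2_mx (x - y)%R)%:E | y in A] <= e%:E].

Definition prokhorov_dist P Q : \bar R :=
  ereal_inf [set e%:E | e in [set e : R | (0 < e)%R /\
    forall A : set M, measurable A -> P A <= Q (enlarge A e) + e%:E]].

(* Hellinger distance between two laws given by densities p and q. *)
Definition hellinger_dist (p q : M -> R) : \bar R :=
  (\int[@lebesgue_mx R d m]_x (((Num.sqrt (p x) - Num.sqrt (q x)) ^+ 2)%R)%:E)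
    `^ (2^-1)%R.

End probability_metrics.

(* Main.v *)
Require Import Defs.
From HB Require Import structures.
From mathcomp Require Import all_boot all_order all_algebra.
From mathcomp Require Import all_classical all_reals all_analysis.
From mathcomp Require Import measurable_realfun ring lra.

(**
The t density p has heavier tails than the rescaled normal density q, and in
fact q <= (1 + b) p everywhere, with b = O((md)^(3/2) / nu). Integrating over a
set and over its complement bounds the total variation by b, and total variation
dominates the other metrics and half the squared Hellinger distance.

For the pointwise bound put h = nu - 2, M = m + d + 1, T = tr(A) with
A = Sigma^-1 X Omega^-1 X^T, and let k be d or m. Concavity of log det at a
multiple of the identity of size k gives
  |I + A / nu|^((h + M) / 2) exp(- h T / (2 nu))
    <= ((1 + M / h)^(h + M) exp(- M))^(k / 2) <= exp(k M^2 / (4 h)),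
while log-convexity of Gamma, in the form
Gamma(a + 1/2) >= sqrt(a - 1/2) Gamma(a), bounds the ratio of the normalising
constants of p and q below by about exp(md(m + d) / (4 h)). With k = min(d, m)
the exponents differ by O(k^2 max(d, m) / h) = O((md)^(3/2) / nu).
*)

Import Order.TTheory GRing.Theory Num.Theory.
Import numFieldNormedType.Exports.

Local Open Scope classical_set_scope.
Local Open Scope ring_scope.

Set Implicit Arguments.
Unset Strict Implicit.
Unset Printing Implicit Defensive.

(** * Dilations of Lebesgue measure *)

Local Notation pushforward_measure :=
  measure_function_pushforward__canonical__measure_function_Measure.

(** By uniqueness of Lebesgue measure: [c] times its pushforward under the dilation gives half-open
    intervals their length. *)
Lemma lebesgue_measure_dilation (R : realType) (c : R) (A : set R) :
  0 < c -> measurable A ->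
  lebesgue_measure ( *%R c @^-1` A) = (c^-1%:E * lebesgue_measure A)%E.
Proof.
move=> c0 mA.
have mc : measurable_fun [set: measurableTypeR R]
    ( *%R c : measurableTypeR R -> measurableTypeR R).
  exact: mulrl_measurable.
pose k : {nonneg R} := NngNum (ltW c0).
pose mu : {measure set (measurableTypeR R) -> \bar R} :=
  mscale k (pushforward_measure lebesgue_measure mc).
have muE X : measurable X -> lebesgue_measure X = mu X.
  apply: lebesgue_measure_unique => _ [[a b] _ <-] /=.
  rewrite /mu /mscale /pushforward /=.
  transitivity (c%:E * lebesgue_measure [set` `]a / c, b / c]%R])%E; last first.
    congr (_ * lebesgue_measure _)%E.
    by apply/seteqP; split=> x /=; rewrite !in_itv /= ltr_pdivrMr// ler_pdivlMr// (mulrC x).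
  rewrite !lebesgue_measure_itv /= !lte_fin; rewrite ltr_pM2r ?invr_gt0//.
  case: ifP => // _; last by rewrite mule0.
  by rewrite -!EFinD -EFinM mulrC -mulrBl mulfVK ?gt_eqF.
rewrite [X in (_ * X)%E]muE// /mu /mscale /pushforward /= muleA -EFinM mulVf ?gt_eqF//.
by rewrite mul1e.
Qed.

Lemma ge0_integral_dilation (R : realType) (c : R) (D : set R) (f : R -> \bar R) :
  0 < c -> measurable D -> measurable_fun D f -> (forall x, D x -> 0 <= f x)%E ->
  (\int[lebesgue_measure]_(x in *%R c @^-1` D) f (c * x)%R =
   c^-1%:E * \int[lebesgue_measure]_(x in D) f x)%E.
Proof.
move=> c0 mD mf f0.
have mc : measurable_fun [set: measurableTypeR R]
    ( *%R c : measurableTypeR R -> measurableTypeR R).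
  exact: mulrl_measurable.
have c0' : 0 <= c^-1 by rewrite invr_ge0 ltW.
rewrite -[RHS](@ge0_integral_mscale _ _ _ lebesgue_measure _ mD (NngNum c0') f)//.
rewrite -(@ge0_integral_pushforward _ _ _ _ _ _ mc lebesgue_measure D f)//.
  apply: eq_measure_integral => A mA AD.
  exact: lebesgue_measure_dilation.
by move=> y /[!inE]; exact: f0.
Qed.

Definition scale_tuple (R : realType) n (c : R) (t : n.-tuple R) : n.-tuple R :=
  [tuple of map ( *%R c) t].

Lemma measurable_scale_tuple (R : realType) n (c : R) :
  measurable_fun [set: n.-tuple R] (@scale_tuple R n c).
Proof.
apply/measurable_fun_tnthP => i.
rewrite (_ : _ \o _ = fun t : n.-tuple R => c * tnth t i); last first.
  by apply/funext => t /=; rewrite tnth_map.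
by apply: measurable_funM => //; exact: measurable_tnth.
Qed.

(** Induction on [n] by sections: the section at [x] of the dilated set is the dilated section of
    [A] at [c * x]. The induction hypothesis gives the factor [c ^- n], and substituting in the
    outer integral gives one more [c^-1]. *)
Lemma lebesgue_tuple_dilation (R : realType) n (c : R) (A : set (n.-tuple R)) :
  0 < c -> measurable A ->
  lebesgue_tuple R n (scale_tuple c @^-1` A) =
  ((c ^- n)%:E * lebesgue_tuple R n A)%E.
Proof.
move=> c0; elim: n A => [|n IH] A mA.
  rewrite expr0 invr1 mul1e (_ : scale_tuple c @^-1` A = A)//.
  by apply/seteqP; split=> t /=; rewrite (tuple0 t) [scale_tuple _ _]tuple0.
rewrite /= /lebesgue_cons /pushforward /product_measure1 /=.
have mA' : measurable (@tuple_cons R n @^-1` A).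
  by rewrite -[X in measurable X]setTI; apply: measurable_funPT.
pose H := (lebesgue_tuple R n \o xsection (@tuple_cons R n @^-1` A)).
have mH : measurable_fun setT H by exact: measurable_fun_xsection.
transitivity (\int[lebesgue_measure]_x ((c ^- n)%:E * H (c * x)%R))%E.
  apply: eq_integral => x _ /=; rewrite /H /= -IH; last exact: measurable_xsection.
  congr (lebesgue_tuple R n _); apply/seteqP; split=> t /=;
    rewrite /xsection /= !inE /=;
    by congr (A _); apply/val_inj.
have mcR : measurable_fun [set: R] ( *%R c) by exact: mulrl_measurable.
rewrite ge0_integralZl//; last 2 first.
  exact: (measurableT_comp mH mcR).
  by rewrite lee_fin invr_ge0 exprn_ge0 ?ltW.
have := @ge0_integral_dilation R c setT H c0 measurableT mH (fun _ _ => measure_ge0 _ _).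
rewrite preimage_setT => ->.
by rewrite muleA -EFinM exprS invfM mulrC.
Qed.

Lemma lebesgue_mx_dilation (R : realType) m n (c : R) (A : set 'M[R]_(m, n)) :
  0 < c -> measurable A ->
  lebesgue_mx (( *:%R c) @^-1` A) = ((c ^- (m * n))%:E * lebesgue_mx A)%E.
Proof.
move=> c0 mA; rewrite /lebesgue_mx /pushforward -lebesgue_tuple_dilation//.
  congr (lebesgue_tuple _ _ _); apply/seteqP; split=> t /=;
  by congr (A _); apply/matrixP => i j; rewrite !mxE tnth_map.
by rewrite -[X in measurable X]setTI; apply: measurable_mx_of_tuple.
Qed.

Lemma measurable_scalemx (R : realType) m n (c : R) :
  measurable_fun [set: 'M[R]_(m, n)] ( *:%R c).
Proof.
apply/measurable_fun_mxP => i j.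
rewrite (_ : (fun t => _) = fun t : 'M[R]_(m, n) => c * t i j).
  by apply: measurable_funM => //; exact: measurable_coord.
by apply/funext => t; rewrite mxE.
Qed.

Lemma ge0_integral_mx_dilation (R : realType) m n (c : R) (D : set 'M[R]_(m, n))
    (f : 'M[R]_(m, n) -> \bar R) :
  0 < c -> measurable D -> measurable_fun D f -> (forall x, D x -> 0 <= f x)%E ->
  (\int[@lebesgue_mx R m n]_(x in ( *:%R c) @^-1` D) f (c *: x)%R =
   (c ^- (m * n))%:E * \int[@lebesgue_mx R m n]_(x in D) f x)%E.
Proof.
move=> c0 mD mf f0.
have mc := @measurable_scalemx R m n c.
have c0' : 0 <= c ^- (m * n) by rewrite invr_ge0 exprn_ge0// ltW.
rewrite -[RHS](@ge0_integral_mscale _ _ _ (@lebesgue_mx R m n) _ mD (NngNum c0') f)//.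
rewrite -(@ge0_integral_pushforward _ _ _ _ _ _ mc (@lebesgue_mx R m n) D f)//.
  apply: (@eq_measure_integral _ _ _ _ _ (pushforward_measure (@lebesgue_mx R m n) mc)).
  by move=> A mA AD; exact: lebesgue_mx_dilation.
by move=> y /[!inE]; exact: f0.
Qed.

(** * The gamma function *)

Section gamma.
Context {R : realType}.
Implicit Types (w t c : R).

Definition gamma_integrand w t : R := t `^ (w - 1) * expR (- t).

Let gamma_funE w :
  \int[lebesgue_measure]_(t in `]0, +oo[) gamma_integrand w t = gamma_fun w.
Proof. by []. Qed.

Let measurable_gamma_integrand w (D : set R) : measurable_fun D (gamma_integrand w).
Proof.
apply: measurable_funM; first exact: measurable_funTS (measurable_powR _).
by apply: measurableT_comp => //; exact: measurable_funTS.
Qed.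

Let gamma_integrand_ge0 w t : 0 <= gamma_integrand w t.
Proof. by rewrite mulr_ge0 ?powR_ge0 ?expR_ge0. Qed.

(* From t <= c exp(t / c) with c = 2 (w - 1). *)
Let gamma_integrand_le w t : 1 < w -> 0 <= t ->
  gamma_integrand w t <= (2 * (w - 1)) `^ (w - 1) * expR (- (t / 2)).
Proof.
move=> w1 t0; have w0 : 0 < w - 1 by rewrite subr_gt0.
have c0 : 0 < 2 * (w - 1) by rewrite mulr_gt0.
rewrite /gamma_integrand.
have tle : t <= 2 * (w - 1) * expR (t / (2 * (w - 1))).
  rewrite mulrC -ler_pdivrMr//.
  by apply: le_trans (expR_ge1Dx _); rewrite lerDr.
have := ge0_ler_powR (ltW w0) t0 (mulr_ge0 (ltW c0) (expR_ge0 _)) tle.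
move=> /(fun h => le_trans (ler_wpM2r (expR_ge0 (- t)) h)); apply.
rewrite (powRM _ (ltW c0) (expR_ge0 _)) -mulrA; apply: ler_wpM2l; first exact: powR_ge0.
rewrite -expRM -expRD ler_expR.
have -> : t / (2 * (w - 1)) * (w - 1) = t / 2 by field; rewrite gt_eqF.
by lra.
Qed.

(** Domination by a multiple of the exponential density of rate 1/2. *)
Lemma integrable_gamma w : 1 < w ->
  lebesgue_measure.-integrable `]0, +oo[ (EFin \o gamma_integrand w).
Proof.
move=> w1.
have : lebesgue_measure.-integrable `]0, +oo[
    (EFin \o (fun t : R => (2 * (w - 1)) `^ (w - 1) * expR (- (t / 2)))).
  have h20 : 0 < 2^-1 :> R by [].
  have : lebesgue_measure.-integrable `]0, +oo[ (EFin \o exponential_pdf (2^-1 : R)).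
    by apply: integrableS (integrable_exponential_pdf h20).
  move=> /integrableZl => /(_ (measurable_itv _) ((2 * (w - 1)) `^ (w - 1) * 2)).
  apply: eq_integrable => // t; rewrite inE/= in_itv/= andbT => t0.
  rewrite /= exponential_pdfE ?ltW//; congr (_%:E).
  by rewrite mulrA mulfK// mulNr (mulrC t).
apply: le_integrable => //.
  by apply/measurable_EFinP; exact: measurable_gamma_integrand.
move=> t; rewrite /= in_itv/= andbT => t0; rewrite lee_fin.
rewrite !ger0_norm// ?mulr_ge0 ?powR_ge0 ?expR_ge0//.
exact: gamma_integrand_le (ltW t0).
Qed.

Lemma gamma_fun_gt0 w : 1 < w -> 0 < gamma_fun w.
Proof.
move=> w1; apply: (@lt_le_trans _ _ (expR (- 2))); first exact: expR_gt0.
rewrite -lee_fin /gamma_fun /Rintegral fineK; last first.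
  exact: integrable_fin_num (integrable_gamma w1).
have -> : (expR (- 2))%:E = (\int[lebesgue_measure]_(t in `]1%R, 2%R[) (expR (- 2))%:E)%E :> \bar R.
  rewrite integral_cst//= lebesgue_measure_itv /= lte_fin ltr1n -EFinD.
  by rewrite (_ : 2 - 1 = 1) ?mule1//; lra.
apply: (@le_trans _ _ (\int[lebesgue_measure]_(t in `]1%R, 2%R[) (gamma_integrand w t)%:E)%E).
  apply: ge0_le_integral => //.
  - by apply/measurable_EFinP; exact: measurable_gamma_integrand.
  move=> t; rewrite /= in_itv/= => /andP[t1 t2]; rewrite lee_fin /gamma_integrand.
  rewrite -[leLHS]mul1r ler_pM ?expR_ge0 ?ler_expR ?lerN2 ?(ltW t2)//.
  by rewrite -[leLHS](powRr0 t) ler_powR ?ltW// subr_gt0.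
apply: ge0_subset_integral => //.
- by apply/measurable_EFinP; exact: measurable_gamma_integrand.
- by move=> t _; rewrite lee_fin.
by move=> t; rewrite /= !in_itv/= => /andP[t1 t2]; rewrite (lt_trans _ t1).
Qed.

Let gamma_dilation w c : 1 < w -> 0 < c ->
  \int[lebesgue_measure]_(t in `]0, +oo[) gamma_integrand w (c * t) =
  c^-1 * gamma_fun w.
Proof.
move=> w1 c0; rewrite /Rintegral.
have pre : *%R c @^-1` `]0, +oo[ = `]0, +oo[%classic.
  by apply/seteqP; split=> t /=; rewrite !in_itv/= !andbT pmulr_rgt0.
have := @ge0_integral_dilation R c `]0, +oo[%classic (EFin \o gamma_integrand w) c0.
rewrite pre => ->//; last 2 first.
- by apply/measurable_EFinP; exact: measurable_gamma_integrand.
- by move=> t _; rewrite lee_fin.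
by rewrite fineM// integrable_fin_num// ; exact: integrable_gamma.
Qed.

(* Put c = expR x and let x tend to 0. *)
Lemma derivative_at1_le w (J0 J1 : R) : 0 < w -> 0 < J0 -> 0 < J1 ->
  (forall c, 1 < c -> c `^ w * (J0 - (c - 1) * J1) <= J0) -> w * J0 <= J1.
Proof.
move=> w0 G0 G1 bound.
have lin x : 0 < x < 1 -> w * J0 - J1 <= x * (w * (J0 + J1)).
  move=> /andP[x0 x1].
  have := bound (expR x); rewrite expR_gt1 => /(_ x0).
  rewrite /powR expR_eq0 expRK -ler_pdivlMl ?expR_gt0// -expRN.
  (* Rational bounds replace both exponentials, so that what remains is a polynomial inequality in
     [x]. *)
  have e1 : expR x - 1 <= x / (1 - x).
    rewrite ler_pdivlMr; last by lra.
    have : expR x * expR (- x) = 1 by rewrite -expRD subrr expR0.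
    have := expR_ge1Dx (- x); have := expR_gt0 x; nra.
  have e2 : expR (- (w * x)) <= 1 / (1 + w * x).
    have wx : 0 < w * x by rewrite mulr_gt0.
    rewrite ler_pdivlMr; last by lra.
    have : expR (w * x) * expR (- (w * x)) = 1 by rewrite -expRD subrr expR0.
    have := expR_ge1Dx (w * x); have := expR_gt0 (- (w * x)); nra.
  move=> B.
  have wx : 0 < w * x by rewrite mulr_gt0.
  have B1 : J0 - x / (1 - x) * J1 <= 1 / (1 + w * x) * J0.
    apply: le_trans (ler_wpM2r (ltW G0) e2); apply: le_trans B.
    by rewrite lerD2l lerN2 ler_wpM2r// ltW.
  have : J0 * (w * x) * (1 - x) <= x * J1 * (1 + w * x).
    have : (J0 - x / (1 - x) * J1) * ((1 - x) * (1 + w * x)) <=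
      1 / (1 + w * x) * J0 * ((1 - x) * (1 + w * x)).
      by rewrite ler_wpM2r// mulr_ge0; lra.
    rewrite (_ : 1 / (1 + w * x) * J0 * ((1 - x) * (1 + w * x)) =
      J0 * (1 - x)); last by field; lra.
    rewrite (_ : (J0 - _) * _ = J0 * ((1 - x) * (1 + w * x)) -
       x * J1 * (1 + w * x)); last by field; lra.
    by lra.
  rewrite (_ : J0 * (w * x) * (1 - x) = x * (w * J0 * (1 - x))); last by ring.
  by rewrite -[x * J1 * _]mulrA ler_pM2l// => B2; lra.
rewrite -subr_le0 leNgt; apply/negP => D0.
set D := w * _ - _ in lin D0; set K := w * (_ + _) in lin.
have K0 : 0 < K by rewrite /K mulr_gt0// addr_gt0.
have DK0 : 0 < 2 * (D + K) by lra.
(* For this [x], [lin] reads D <= D K / (2 (D + K)), whose right side is below D / 2. *)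
have xDK : 0 < D / (2 * (D + K)) < 1.
  by rewrite divr_gt0//= ltr_pdivrMr//; lra.
have := lin _ xDK; rewrite mulrAC ler_pdivlMr//.
by nra.
Qed.

(* Dilating the integral by c and letting c decrease to 1 replaces an integration
   by parts. *)
Lemma gamma_funD1_ge w : 1 < w -> w * gamma_fun w <= gamma_fun (w + 1).
Proof.
move=> w1; have w0 : 0 < w by lra.
have w11 : 1 < w + 1 by lra.
have mI : measurable (`]0%R, +oo[%classic : set (measurableTypeR R)).
  exact: measurable_itv.
have I0 := integrable_gamma w1; have I1 := integrable_gamma w11.
(* Integrate exp(- c t) >= exp(- t) (1 - (c - 1) t) against (c t)^(w - 1). The left side becomes
   Gamma(w) / c by dilation. *)
have bound c : 1 < c ->
    c `^ w * (gamma_fun w - (c - 1) * gamma_fun (w + 1)) <= gamma_fun w.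
  move=> c1; have c0 : 0 < c by lra.
  have fE t : 0 < t -> gamma_integrand w (c * t) =
      c `^ (w - 1) * (t `^ (w - 1) * (expR (- t) * expR (- ((c - 1) * t)))).
    move=> t0; rewrite /gamma_integrand powRM ?ltW// -mulrA -expRD.
    by congr (_ * (_ * expR _)); lra.
  have fSE t : 0 < t -> gamma_integrand (w + 1) t = t `^ (w - 1) * (expR (- t) * t).
    move=> t0; rewrite /gamma_integrand addrK -(mulr_powRB1 (ltW t0) w0).
    by ring.
  have mfc : measurable_fun (`]0%R, +oo[%classic : set R)
      (fun t => gamma_integrand w (c * t)).
    have mc : measurable_fun (`]0%R, +oo[%classic : set R) ( *%R c).
      by apply: measurable_funTS; exact: mulrl_measurable.
    exact: (measurableT_comp (@measurable_gamma_integrand w setT) mc).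
  have I2 : lebesgue_measure.-integrable `]0, +oo[
      (EFin \o (fun t => gamma_integrand w (c * t))).
    have := integrableZl mI (c `^ (w - 1)) I0.
    apply: le_integrable => //.
      by apply/measurable_EFinP; exact: mfc.
    move=> t; rewrite /= in_itv/= andbT => t0; rewrite lee_fin.
    rewrite !ger0_norm// ?mulr_ge0 ?powR_ge0//.
    rewrite fE// !ler_wpM2l ?powR_ge0// -[leRHS]mulr1 ler_wpM2l ?expR_ge0//.
    by rewrite expR_le1 oppr_le0; apply: mulr_ge0; [lra|exact: ltW].
  have I3 := integrableZl mI (c - 1) I1.
  have I4 := integrableB mI I0 I3.
  have I5 := integrableZl mI (c `^ (w - 1)) I4.
  have := @le_Rintegral _ _ _ lebesgue_measure `]0, +oo[%classic
    (fun t => c `^ (w - 1) * (gamma_integrand w t - (c - 1) * gamma_integrand (w + 1) t))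
    _ mI I5 I2.
  rewrite gamma_dilation// RintegralZl// RintegralB// RintegralZl//.
  rewrite !gamma_funE.
  move=> H; rewrite -(mulr_powRB1 (ltW c0) w0) -mulrA mulrC -ler_pdivlMr// (mulrC _ c^-1).
  apply: H => t; rewrite /= in_itv/= andbT => t0.
  rewrite fE// fSE// /gamma_integrand ler_wpM2l ?powR_ge0//.
  rewrite (_ : _ - _ = t `^ (w - 1) * (expR (- t) * (1 - (c - 1) * t))); last by ring.
  rewrite !ler_wpM2l ?powR_ge0 ?expR_ge0//.
  exact: expR_ge1Dx.
exact: derivative_at1_le w0 (gamma_fun_gt0 w1) (gamma_fun_gt0 w11) bound.
Qed.

(* AM-GM: 2 sqrt w t^(w - 1/2) <= t^w + w t^(w - 1). *)
Lemma gamma_fun_half_ge w : 1 < w ->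
  Num.sqrt w * gamma_fun (w + 2^-1) <= gamma_fun (w + 1).
Proof.
move=> w1; have w0 : 0 < w by lra.
have mI : measurable (`]0%R, +oo[%classic : set (measurableTypeR R)).
  exact: measurable_itv.
have w11 : 1 < w + 1 by lra.
have w12 : 1 < w + 2^-1 by lra.
have I0 := integrable_gamma w1; have I1 := integrable_gamma w11.
have I2 := integrable_gamma w12.
(* By [gamma_funD1_ge] the right side is at most twice [gamma_fun (w + 1)]. *)
suff : (2 * Num.sqrt w) * gamma_fun (w + 2^-1) <= gamma_fun (w + 1) + w * gamma_fun w.
  move: (gamma_funD1_ge w1).
  by move: (gamma_fun w) (gamma_fun (w + 1)) (gamma_fun (w + 2^-1)) => *; lra.
have I3 := integrableZl mI (2 * Num.sqrt w) I2.
have I4 := integrableZl mI w I0.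
have I5 := integrableD mI I1 I4.
have := @le_Rintegral _ _ _ lebesgue_measure `]0, +oo[%classic
    (fun t => (2 * Num.sqrt w) * gamma_integrand (w + 2^-1) t)
    (fun t => gamma_integrand (w + 1) t + w * gamma_integrand w t)
    mI I3 I5.
rewrite RintegralZl// RintegralD// RintegralZl// !gamma_funE; apply => t.
rewrite /= in_itv/= andbT => t0; rewrite /gamma_integrand addrK.
have -> : w + 2^-1 - 1 = w - 1 + 2^-1 by ring.
rewrite powRD ?(gt_eqF t0) ?implybT// powR12_sqrt ?(ltW t0)//.
rewrite -(mulr_powRB1 (ltW t0) w0).
set a := t `^ _; set e := expR _.
have ae : 0 <= a * e by rewrite mulr_ge0 ?powR_ge0 ?expR_ge0.
have := sqr_ge0 (Num.sqrt w - Num.sqrt t).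
have := sqr_sqrtr (ltW w0); have := sqr_sqrtr (ltW t0).
set u := Num.sqrt w; set v := Num.sqrt t => hv hu h.
rewrite -subr_ge0 (_ : _ - _ = a * e * ((u - v) ^+ 2)); first by rewrite mulr_ge0.
by rewrite -hv -hu; ring.
Qed.

End gamma.

(** * Positive definite matrices *)

Section posdef.
Context {R : realType}.

(* The bound on the determinant is Hadamard's inequality combined
   with l ^+ 2 <= expR (l ^+ 2 - 1) on the diagonal. *)
Lemma posdefmx_cholesky n (A : 'M[R]_n) : posdefmx A ->
  exists L : 'M[R]_n,
    [/\ A = L *m L^T, \det L != 0 & \det L ^+ 2 <= expR (\tr A - n%:R)].
Proof.
elim: n A => [|n IH] A [symA posA].
  exists A; split; first by apply/matrixP => -[].
    by rewrite det_mx00 oner_neq0.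
  by rewrite det_mx00 expr1n /mxtrace big_ord0 subrr expR0.
rewrite -[n.+1]/(1 + n)%N in A symA posA *.
pose a : R := A 0 0; pose b : 'rV[R]_n := ursubmx A; pose C : 'M[R]_n := drsubmx A.
have AE : A = block_mx a%:M b b^T C.
  rewrite -[LHS]submxK; congr block_mx.
    by rewrite [LHS]mx11_scalar !mxE; congr (A _ _)%:M; apply/val_inj.
  by rewrite /b trmx_ursub symA.
have symC : C^T = C by rewrite /C trmx_drsub symA.
have quad (x : 'cV[R]_1) (y : 'cV[R]_n) :
    (col_mx x y)^T *m A *m col_mx x y =
    a *: (x^T *m x) + x^T *m (b *m y) + y^T *m b^T *m x + y^T *m C *m y.
  rewrite {1}AE tr_col_mx mul_row_block mul_row_col !mulmxDl mul_mx_scalar.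
  rewrite -scalemxAl -!mulmxA; rewrite !addrA; congr (_ + _).
  by rewrite -!addrA; congr (_ + _); rewrite addrC.
have a0 : 0 < a.
  have := posA (col_mx 1%:M 0); rewrite quad !mulmx0 trmx0 !mul0mx !addr0.
  rewrite trmx1 mulmx1 !mxE eqxx mulr1; apply.
  apply/eqP => /(congr1 usubmx); rewrite col_mxKu linear0 => /matrixP/(_ 0 0).
  by rewrite !mxE eqxx => /eqP; rewrite oner_eq0.
pose S := C - a^-1 *: (b^T *m b).
(* The form of the Schur complement at [y] is the form of [A] at the vector whose first block
   [- a^-1 *: (b *m y)] minimises it for the given [y]. *)
have pS : posdefmx S.
  split; first by rewrite /S linearB /= linearZ /= trmx_mul trmxK symC.
  move=> y y0; have := posA (col_mx (- a^-1 *: (b *m y)) y); rewrite quad.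
  set z := b *m y.
  have -> : y^T *m b^T = z^T by rewrite trmx_mul.
  rewrite (_ : y^T *m S *m y = y^T *m C *m y - a^-1 *: (z^T *m z)); last first.
    rewrite /S mulmxBr mulmxBl; congr (_ - _).
    by rewrite -scalemxAr -scalemxAl /z trmx_mul !mulmxA.
  rewrite (_ : _ + _ = y^T *m C *m y - a^-1 *: (z^T *m z)); last first.
    have -> : (- a^-1 *: z)^T = - a^-1 *: z^T by rewrite linearZ.
    rewrite -!scalemxAl -!scalemxAr addrC; congr (_ + _).
    rewrite !scalerA -!scalerDl -scaleNr; congr (_ *: _).
    by field; rewrite gt_eqF.
  apply; apply/eqP => /(congr1 dsubmx); rewrite col_mxKd linear0 => /eqP.
  by rewrite (negbTE y0).
have [L [SE L0 Lle]] := IH _ pS.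
pose r := Num.sqrt a.
have r0 : 0 < r by rewrite sqrtr_gt0.
have rr : r ^+ 2 = a by rewrite sqr_sqrtr// ltW.
exists (block_mx r%:M 0 (r^-1 *: b^T) L); split.
- rewrite tr_block_mx mulmx_block !trmx0 !mul0mx !mulmx0 !addr0 tr_scalar_mx.
  rewrite -scalar_mxM -expr2 rr linearZ /= trmxK mul_scalar_mx scalerA.
  rewrite mulfV ?gt_eqF// scale1r mul_mx_scalar scalerA mulfV ?gt_eqF// scale1r.
  rewrite AE; congr block_mx; rewrite -scalemxAl -scalemxAr scalerA -invfM -expr2 rr.
  by rewrite -SE /S addrC subrK.
- by rewrite det_lblock det_scalar1 mulf_neq0// gt_eqF.
rewrite det_lblock det_scalar1 exprMn rr AE mxtrace_block.
(* Passing to the Schur complement subtracts a Gram matrix, so the trace can only drop and the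
   inductive bound survives. *)
have trS : \tr S <= \tr C.
  rewrite /S linearB /= gerBl linearZ /= mulr_ge0 ?invr_ge0 ?(ltW a0)//.
  rewrite /mxtrace sumr_ge0// => i _; rewrite mxE big_ord_recl big_ord0 addr0.
  by rewrite mxE -expr2 sqr_ge0.
rewrite mxtrace_scalar mulr1n natrD opprD addrACA expRD.
rewrite ler_pM ?sqr_ge0// ?(ltW a0)//.
  apply: le_trans (expR_ge1Dx _); lra.
by apply: le_trans Lle _; rewrite ler_expR lerD2r.
Qed.

Lemma posdefmx_det_gt0 n (A : 'M[R]_n) : posdefmx A -> 0 < \det A.
Proof.
move=> /posdefmx_cholesky[L [-> L0 _]].
by rewrite det_mulmx det_tr -expr2 exprn_even_gt0.
Qed.

Lemma posdefmx_det_le n (A : 'M[R]_n) : posdefmx A ->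
  \det A <= expR (\tr A - n%:R).
Proof.
by move=> /posdefmx_cholesky[L [AE _]]; rewrite {2}AE det_mulmx det_tr.
Qed.

(** Sylvester's identity: two block eliminations compute the determinant of the same matrix [M]. *)
Lemma det_1D_mulmxC m n (A : 'M[R]_(m, n)) (B : 'M[R]_(n, m)) :
  \det (1%:M + A *m B) = \det (1%:M + B *m A).
Proof.
pose M := block_mx 1%:M (- A) B 1%:M.
transitivity (\det M).
  have /(congr1 determinant) : block_mx 1%:M A 0 1%:M *m M =
      block_mx (1%:M + A *m B) 0 B 1%:M.
    by rewrite mulmx_block !mul0mx !mulmx1 !mul1mx !add0r addNr.
  by rewrite det_mulmx det_ublock det_lblock !det1 !mulr1 mul1r.
have /(congr1 determinant) : block_mx 1%:M 0 (- B) 1%:M *m M =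
    block_mx 1%:M (- A) 0 (1%:M + B *m A).
  rewrite mulmx_block !mul0mx !mulmx1 !mul1mx !addr0 addNr mulNmx mulmxN opprK.
  by rewrite [X in block_mx _ _ _ X]addrC.
by rewrite det_mulmx det_ublock det_lblock !det1 !mul1r.
Qed.

Lemma det_1DZ_mulmxC m n (c : R) (A : 'M[R]_(m, n)) (B : 'M[R]_(n, m)) :
  \det (1%:M + c *: (A *m B)) = \det (1%:M + c *: (B *m A)).
Proof. by rewrite scalemxAl det_1D_mulmxC scalemxAr. Qed.

Lemma posdefmx_1D_gram k l (c : R) (Z : 'M[R]_(k, l)) : 0 <= c ->
  posdefmx (1%:M + c *: (Z *m Z^T)).
Proof.
move=> c0; split.
  by rewrite linearD /= linearZ /= trmx1 trmx_mul trmxK.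
move=> v v0; rewrite mulmxDr mulmxDl mulmx1 -scalemxAr -scalemxAl mxE [X in _ + X]mxE.
have gram p (w : 'cV[R]_p) : (w^T *m w) 0 0 = \sum_i w i 0 ^+ 2.
  by rewrite mxE; apply: eq_bigr => i _; rewrite mxE expr2.
have -> : v^T *m (Z *m Z^T) *m v = (Z^T *m v)^T *m (Z^T *m v).
  by rewrite trmx_mul trmxK !mulmxA.
rewrite !gram ltr_pwDl ?mulr_ge0//; last by rewrite sumr_ge0// => i _; exact: sqr_ge0.
rewrite lt_neqAle sumr_ge0 ?andbT; last by move=> i _; exact: sqr_ge0.
rewrite eq_sym psumr_eq0; last by move=> i _; exact: sqr_ge0.
apply: contra v0 => /allP z; apply/eqP/matrixP => i j.
have := z i (mem_index_enum _); rewrite sqrf_eq0 => /eqP.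
by rewrite (ord1 j) mxE.
Qed.

Lemma det_1D_gram_gt0 k l (c : R) (Z : 'M[R]_(k, l)) : 0 <= c ->
  0 < \det (1%:M + c *: (Z *m Z^T)).
Proof. by move=> c0; exact/posdefmx_det_gt0/posdefmx_1D_gram. Qed.

(* Tangent line of the concave function log det at a multiple of the identity. *)
Lemma det_1D_gram_le k l (c s : R) (Z : 'M[R]_(k, l)) : 0 <= c -> 0 < s ->
  \det (1%:M + c *: (Z *m Z^T)) <=
  s ^- k * expR (k%:R * (s - 1) + s * c * \tr (Z *m Z^T)).
Proof.
move=> c0 s0; set B := (1%:M + _).
have [symB posB] : posdefmx B by exact: posdefmx_1D_gram.
(* The bound det <= exp(tr - k) is tangent at the identity. Applied to [s *: B], it becomes tangent
   at B = I / s. *)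
have : posdefmx (s *: B).
  split; first by rewrite linearZ /= symB.
  by move=> v v0; rewrite -scalemxAr -scalemxAl mxE mulr_gt0// posB.
move=> /posdefmx_det_le; rewrite detZ -ler_pdivlMl ?exprn_gt0//.
move=> /le_trans; apply; rewrite ler_wpM2l ?invr_ge0 ?exprn_ge0 ?(ltW s0)//.
rewrite ler_expR /B linearZ /= linearD /= linearZ /= mxtrace1.
by rewrite le_eqVlt; apply/orP; left; apply/eqP; ring.
Qed.

(** [G] is the inverse of the Cholesky factor. This form lets [kernel_gram] turn the kernel into a
    Gram matrix. *)
Lemma posdefmx_inv n (A : 'M[R]_n) : posdefmx A ->
  exists G : 'M[R]_n, invmx A = G^T *m G.
Proof.
move=> /posdefmx_cholesky[L [-> L0 _]]; exists (invmx L).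
have uL : L \in unitmx by rewrite unitmxE unitfE.
rewrite trmx_inv; apply: (@row_free_inj _ _ _ _ (L *m L^T)).
  by rewrite row_free_unit unitmx_mul uL unitmx_tr.
rewrite mulVmx ?unitmx_mul ?uL ?unitmx_tr//.
by rewrite -mulmxA (mulmxA (invmx L)) mulVmx// mul1mx mulVmx// unitmx_tr.
Qed.

End posdef.

(** * Normalising constants *)

Section real.
Context {R : realType}.
Implicit Types x y u a z h nu : R.

(** The difference vanishes at 0 and has derivative e^y + e^(-y) - 2 >= 0, so the mean value theorem
    applies. *)
Lemma le_sinh x : 0 <= x -> 2 * x <= expR x - expR (- x).
Proof.
rewrite le_eqVlt => /predU1P[<-|x0]; first by rewrite oppr0 subrr mulr0.
pose f y : R := expR y - expR (- y) - 2 * y.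
pose df y : R := expR y + expR (- y) - 2.
have df_ y : is_derive y 1 f (df y).
  rewrite /f; apply: is_derive_eq.
  by rewrite /df /GRing.scale /=; ring.
have cf : {within `[0, x], continuous f}.
  by apply: derivable_within_continuous => y _; apply: ex_derive.
have [c _] := MVT x0 (fun y _ => df_ y) cf.
rewrite /f oppr0 mulr0 !subrr !subr0 addr0 => fE.
rewrite -subr_ge0 fE mulr_ge0 ?(ltW x0)// /df.
have : expR c * expR (- c) = 1 by rewrite -expRD subrr expR0.
have := expR_gt0 c; have := expR_gt0 (- c).
set p := expR c; set q := expR (- c) => q0 p0 pq.
have := sqr_ge0 (p - q); nra.
Qed.

(** [le_sinh] at ln(1 + u) reads 2 ln(1 + u) <= (1 + u) - 1 / (1 + u). Multiply by (1 + u) / 2. *)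
Lemma ln1D_le u : 0 <= u -> (1 + u) * ln (1 + u) <= u + u ^+ 2 / 2.
Proof.
move=> u0; have u1 : 0 < 1 + u by lra.
have l0 : 0 <= ln (1 + u) by apply: ln_ge0; lra.
have := le_sinh l0; rewrite expRN lnK ?posrE//.
set l := ln _; rewrite -subr_ge0 => H.
rewrite -subr_ge0.
have -> : u + u ^+ 2 / 2 - (1 + u) * l = (1 + u - (1 + u)^-1 - 2 * l) * ((1 + u) / 2).
  by field; rewrite gt_eqF.
by rewrite mulr_ge0//; lra.
Qed.

(** From exp(- t) >= 1 - t at t = y / (1 + y) comes 1 + y >= exp(y / (1 + y)), and y / (1 + y) >= y
    - y^2. *)
Lemma expR_subsqr_le1D y : 0 <= y -> expR (y - y ^+ 2) <= 1 + y.
Proof.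
move=> y0; have y1 : 0 < 1 + y by lra.
have : (1 + y)^-1 <= expR (- (y / (1 + y))).
  apply: le_trans (expR_ge1Dx _).
  by rewrite [leRHS](_ : _ = (1 + y)^-1)//; field; rewrite gt_eqF.
rewrite expRN lef_pV2 ?posrE ?expR_gt0// => H; apply: le_trans H.
rewrite ler_expR ler_pdivlMr//; nra.
Qed.

(** Iterates [gamma_fun_half_ge] over [m] half steps. The bound on [a] keeps every argument a + k /
    2 - 1 / 2 above 1. *)
Lemma gamma_fun_add_half_ge a (m : nat) : 3 / 2 < a ->
  (\prod_(k < m) Num.sqrt (a + k%:R / 2 - 2^-1)) * gamma_fun a <=
  gamma_fun (a + m%:R / 2).
Proof.
move=> a1; elim: m => [|m IH]; first by rewrite big_ord0 mul1r mul0r addr0.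
rewrite big_ord_recr /= mulrAC mulrC.
have m0 : 0 <= m%:R :> R by [].
have w1 : 1 < a + m%:R / 2 - 2^-1 by lra.
have := gamma_fun_half_ge w1; rewrite subrK.
have -> : a + m%:R / 2 - 2^-1 + 1 = a + m.+1%:R / 2 by rewrite -natr1; field.
by apply: le_trans; rewrite ler_wpM2l ?sqrtr_ge0.
Qed.

Lemma mgamma_fun_gt0 (d : nat) z : d%:R / 2 + 1 <= z -> 0 < mgamma_fun d z.
Proof.
move=> dz; rewrite /mgamma_fun mulr_gt0 ?powR_gt0 ?pi_gt0//.
rewrite big_add1 big_mkord prodr_gt0// => j _; apply: gamma_fun_gt0.
have : j%:R < d%:R :> R by rewrite ltr_nat.
rewrite -natr1; lra.
Qed.

Lemma mgamma_fun_ratio_ge (d m : nat) nu : 4 < nu ->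
  \prod_(j < d) \prod_(k < m) Num.sqrt ((nu - 2 + (d%:R - j%:R + k%:R)) / 2) <=
  mgamma_fun d ((nu + m%:R + d%:R - 1) / 2) / mgamma_fun d ((nu + d%:R - 1) / 2).
Proof.
move=> nu4.
have d0 : 0 <= d%:R :> R by [].
rewrite ler_pdivlMr; last by apply: mgamma_fun_gt0; lra.
rewrite /mgamma_fun mulrCA; apply: ler_wpM2l; first exact: powR_ge0.
rewrite !big_add1 !big_mkord -big_split /=; apply: ler_prod => j _.
have jd : j%:R + 1 <= d%:R :> R by rewrite natr1 ler_nat.
have jS : j.+1%:R = j%:R + 1 :> R by rewrite natr1.
apply/andP; split.
  apply: mulr_ge0; first by apply: prodr_ge0 => k _; exact: sqrtr_ge0.
  by apply/ltW/gamma_fun_gt0; rewrite jS; lra.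
have := @gamma_fun_add_half_ge ((nu + d%:R - 1) / 2 - (j.+1%:R - 1) / 2) m.
rewrite (_ : (nu + d%:R - 1) / 2 - (j.+1%:R - 1) / 2 + m%:R / 2 =
   (nu + m%:R + d%:R - 1) / 2 - (j.+1%:R - 1) / 2); last by field.
have h : 3 / 2 < (nu + d%:R - 1) / 2 - (j.+1%:R - 1) / 2 by rewrite jS; lra.
move=> /(_ h); apply: le_trans.
rewrite le_eqVlt; apply/orP; left; apply/eqP; congr (_ * _).
by apply: eq_bigr => k _; congr Num.sqrt; rewrite jS; field.
Qed.

Lemma sum_natr_ord (n : nat) : \sum_(i < n) (i%:R : R) = n%:R * (n%:R - 1) / 2.
Proof.
elim: n => [|n IH]; first by rewrite big_ord0 !mul0r.
by rewrite big_ord_recr /= IH -natr1; field.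
Qed.

(* The sum of d - j + k over j < d and k < m is md(m + d) / 2. *)
Lemma prod_sqrt_ge (d m : nat) h : 0 < h ->
  (h / 2) `^ ((m * d)%:R / 2) *
    expR ((m * d)%:R * (m + d)%:R / (4 * h) -
          (m * d)%:R * (m + d)%:R ^+ 2 / (2 * h ^+ 2)) <=
  \prod_(j < d) \prod_(k < m) Num.sqrt ((h + (d%:R - j%:R + k%:R)) / 2).
Proof.
move=> h0.
have h20 : 0 < h / 2 by rewrite divr_gt0.
pose x (j k : nat) : R := d%:R - j%:R + k%:R.
pose y (j k : nat) : R := x j k / h.
have sx : \sum_(j < d) \sum_(k < m) x j k = (m * d)%:R * (m + d)%:R / 2.
  transitivity (\sum_(j < d) (m%:R * d%:R - m%:R * j%:R + m%:R * (m%:R - 1) / 2 : R)).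
    apply: eq_bigr => j _; rewrite big_split /= sumr_const card_ord sum_natr_ord.
    by rewrite -mulr_natl; ring.
  rewrite big_split /= sumrB !sumr_const card_ord -mulr_sumr sum_natr_ord.
  rewrite -(mulr_natl (m%:R * d%:R)) -(mulr_natl (m%:R * (m%:R - 1) / 2)).
  by rewrite natrM natrD; field.
have xle (j : 'I_d) (k : 'I_m) : 0 <= x j k <= (m + d)%:R.
  have : j%:R + 1 <= d%:R :> R by rewrite natr1 ler_nat.
  have : k%:R + 1 <= m%:R :> R by rewrite natr1 ler_nat.
  have : 0 <= k%:R :> R by []. have : 0 <= j%:R :> R by [].
  by rewrite /x natrD => ? ? ? ?; apply/andP; split; lra.
(* Each radicand is (h / 2)(1 + y), and 1 + y >= exp(y - y^2). The linear terms sum exactly to the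
   first exponent; the squares are bounded through x <= m + d. *)
apply: (@le_trans _ _ (\prod_(j < d) \prod_(k < m)
  ((h / 2) `^ (2^-1) * expR ((y j k - y j k ^+ 2) / 2)))); last first.
  apply: ler_prod => j _; rewrite prodr_ge0/=; last first.
    by move=> k _; rewrite mulr_ge0 ?powR_ge0 ?expR_ge0.
  apply: ler_prod => k _; rewrite mulr_ge0 ?powR_ge0 ?expR_ge0//=.
  have y0 : 0 <= y j k by rewrite divr_ge0 ?(ltW h0)//; case/andP: (xle j k).
  rewrite (_ : (h + _) / 2 = h / 2 * (1 + y j k)); last first.
    by rewrite /y /x; field; rewrite gt_eqF.
  rewrite sqrtrM ?(ltW h20)// powR12_sqrt ?(ltW h20)//.
  rewrite ler_wpM2l ?sqrtr_ge0// expRM -[leRHS]powR12_sqrt; last by lra.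
  by rewrite ge0_ler_powR ?nnegrE ?expR_ge0 ?expR_subsqr_le1D//; lra.
rewrite (eq_bigr (fun j : 'I_d => (h / 2) `^ (2^-1) ^+ m *
  expR (\sum_(k < m) (y j k - y j k ^+ 2) / 2))); last first.
  by move=> j _; rewrite big_split /= prodr_const card_ord expR_sum.
rewrite big_split /= prodr_const card_ord -expR_sum -exprM -[X in _ <= X * _]powR_mulrn ?powR_ge0//.
rewrite -powRrM (mulrC 2^-1) ler_wpM2l ?powR_ge0// ler_expR.
have -> : (m * d)%:R * (m + d)%:R / (4 * h) = \sum_(j < d) \sum_(k < m) (y j k / 2).
  rewrite (_ : _ / (4 * h) = (m * d)%:R * (m + d)%:R / 2 * (2 * h)^-1); last first.
    by field; rewrite gt_eqF.
  rewrite -sx mulr_suml; apply: eq_bigr => j _; rewrite mulr_suml.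
  by apply: eq_bigr => k _; rewrite /y; field; rewrite gt_eqF.
have -> : (m * d)%:R * (m + d)%:R ^+ 2 / (2 * h ^+ 2) =
    \sum_(j < d) \sum_(k < m) ((m + d)%:R ^+ 2 / (2 * h ^+ 2)).
  by rewrite !sumr_const !card_ord -mulrnA -[RHS]mulr_natl mulrA.
rewrite -sumrB; apply: ler_sum => j _; rewrite -sumrB; apply: ler_sum => k _.
rewrite mulrBl lerD2l lerN2.
have /andP[x0 xm] := xle j k.
rewrite /y (_ : _ / 2 = x j k ^+ 2 / (2 * h ^+ 2)); last by field; rewrite gt_eqF.
apply: ler_wpM2r; first by rewrite invr_ge0 mulr_ge0 ?sqr_ge0.
by rewrite lerXn2r ?nnegrE.
Qed.

End real.

(** * Comparison of the densities *)

Section pointwise.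
Context {R : realType} {d m : nat}.
Variables (Sigma : 'M[R]_d) (Omega : 'M[R]_m).
Hypotheses (pSigma : posdefmx Sigma) (pOmega : posdefmx Omega).
Implicit Types (X : 'M[R]_(d, m)) (nu : R).

Local Notation A X := (invmx Sigma *m X *m invmx Omega *m X^T).

(** The kernel itself need not be symmetric. Writing the inverses as G^T G and H^T H and moving the
    leading G^T cyclically to the end gives Z = G X H^T. *)
Lemma kernel_gram X : exists Z : 'M[R]_(d, m),
  \tr (A X) = \tr (Z *m Z^T) /\
  forall c, \det (1%:M + c *: A X) = \det (1%:M + c *: (Z *m Z^T)).
Proof.
have [G ->] := posdefmx_inv pSigma; have [H ->] := posdefmx_inv pOmega.
exists (G *m X *m H^T).
have E : G^T *m G *m X *m (H^T *m H) *m X^T = G^T *m (G *m X *m H^T *m H *m X^T).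
  by rewrite !mulmxA.
have F : G *m X *m H^T *m H *m X^T *m G^T =
    (G *m X *m H^T) *m (G *m X *m H^T)^T.
  by rewrite !trmx_mul trmxK !mulmxA.
split=> [|c]; rewrite E; first by rewrite mxtrace_mulC F.
by rewrite det_1DZ_mulmxC F.
Qed.

(** The case [k = m] is the tangent bound for [Z^T], since Z Z^T and Z^T Z share their trace and, by
    Sylvester's identity, this determinant. *)
Lemma det_kernel_le (k : nat) c s X : (k == d) || (k == m) -> 0 <= c -> 0 < s ->
  0 < \det (1%:M + c *: A X) <=
  s ^- k * expR (k%:R * (s - 1) + s * c * \tr (A X)).
Proof.
move=> kdm c0 s0; have [Z [-> ->]] := kernel_gram X; rewrite det_1D_gram_gt0//=.
case/orP: kdm => /eqP ->; first exact: det_1D_gram_le.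
have := @det_1D_gram_le R _ _ c s Z^T c0 s0; rewrite trmxK => H.
by rewrite det_1DZ_mulmxC [\tr _]mxtrace_mulC.
Qed.

(* The tangent point s is chosen so that the trace enters the bound with exactly
   the coefficient it has in the rescaled normal density. *)
Lemma det_kernel_powR_ge (k : nat) nu X : (k == d) || (k == m) -> 2 < nu ->
  expR (- ((nu - 2) / (2 * nu) * \tr (A X)) -
        k%:R * (m + d + 1)%:R ^+ 2 / (4 * (nu - 2))) <=
  \det (1%:M + nu^-1 *: A X) `^ (- ((nu + m%:R + d%:R - 1) / 2)).
Proof.
move=> kdm nu2; pose h := nu - 2; pose M : R := (m + d + 1)%:R.
have nu0 : 0 < nu by lra.
have h0 : 0 < h by rewrite /h; lra.
have M0 : 0 <= M by rewrite /M.
have hM : 0 < h + M by lra.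
have nzE := (lt0r_neq0 nu0, lt0r_neq0 h0, lt0r_neq0 hM).
have NE : nu + m%:R + d%:R - 1 = h + M by rewrite /h /M !natrD; ring.
rewrite NE -/h -/M; clearbody h M.
have s0 : 0 < h / (h + M) by rewrite divr_gt0.
have nuV0 : 0 <= nu^-1 by rewrite invr_ge0 ltW.
have /andP[D0] := @det_kernel_le k nu^-1 _ X kdm nuV0 s0.
set D := \det _ in D0 *; set T := \tr _ => Dle.
rewrite /powR gt_eqF// ler_expR.
have lnD : ln D <= k%:R * ln (1 + M / h) - k%:R * (M / (h + M)) + h / (h + M) / nu * T.
  have lnDle := Dle; rewrite -ler_ln ?posrE ?(lt_le_trans D0 Dle)// in lnDle.
  move: lnDle; rewrite lnM ?posrE ?expR_gt0 ?invr_gt0 ?exprn_gt0// expRK -exprVn lnXn ?invr_gt0//.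
  move=> /le_trans; apply.
  rewrite invf_div (_ : (h + M) / h = 1 + M / h); last by field; rewrite ?nzE.
  rewrite -[ln _ *+ k]mulr_natl.
  by rewrite le_eqVlt; apply/orP; left; apply/eqP; field; rewrite ?nzE.
have uh0 : 0 <= M / h by rewrite divr_ge0 ?(ltW h0).
have L := ln1D_le uh0.
rewrite mulNr -opprD lerN2 [leLHS]mulrC.
apply: (le_trans (ler_wpM2r _ lnD)); first by lra.
(* With u = M / h the logarithmic term is at most k M / 2 + k M^2 / (4 h). Its first part cancels
   the - k M / 2 left by the tangent line. *)
have kL : k%:R * h / 2 * ((1 + M / h) * ln (1 + M / h)) <=
    k%:R * h / 2 * (M / h + (M / h) ^+ 2 / 2).
  by rewrite ler_wpM2l// divr_ge0 ?mulr_ge0 ?(ltW h0).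
set l := ln _ in kL *.
rewrite (_ : (_ - _ + _) * _ =
  k%:R * h / 2 * ((1 + M / h) * l) - k%:R * M / 2 + h / (2 * nu) * T); last first.
  by field; rewrite ?nzE.
rewrite [leRHS]addrC lerD2r.
rewrite lerBlDr; apply: le_trans kL _.
by rewrite le_eqVlt; apply/orP; left; apply/eqP; field; rewrite ?nzE.
Qed.

End pointwise.

(** * Size of the total exponent *)

Section bound.
Context {R : realType}.

(** k^2 l = (k l) k, and k <= sqrt(k l). This is where the power 3/2 arises. *)
Lemma powR32_ge_sqr (k l : nat) : (0 < k <= l)%N ->
  k%:R ^+ 2 * l%:R <= (k * l)%:R `^ (3 / 2) :> R.
Proof.
move=> /andP[k0 kl]; have kl0 : (0 < k * l)%N by rewrite muln_gt0 k0 (leq_trans k0).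
have kl0R : 0 < (k * l)%:R :> R by rewrite ltr0n.
have -> : 3 / 2 = 1 + 2^-1 :> R by field.
rewrite powRD ?(gt_eqF kl0R) ?implybT// powRr1 ?(ltW kl0R)// powR12_sqrt ?(ltW kl0R)//.
have -> : k%:R ^+ 2 * l%:R = (k * l)%:R * k%:R :> R by rewrite natrM; ring.
rewrite ler_wpM2l// -[leLHS](ger0_norm (ler0n _ k)) -sqrtr_sqr ler_wsqrtr//.
by rewrite -natrX ler_nat expnS expn1 leq_mul2l kl orbT.
Qed.

(** With k = min(d, m) and l = max(d, m), the terms k l^2 / (4 h) of the kernel and constant bounds
    cancel. What is left is of order k^2 l / h, hence of order (k l)^(3/2) / h; the lower bound on
    [nu] absorbs the term in 1 / h^2. *)
Lemma exponent_le (d m : nat) (nu : R) : (0 < d)%N -> (0 < m)%N ->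
  4 <= nu -> 2 + 2 * (m + d)%:R ^+ 2 <= nu ->
  (minn d m)%:R * (m + d + 1)%:R ^+ 2 / (4 * (nu - 2)) -
  ((m * d)%:R * (m + d)%:R / (4 * (nu - 2)) -
   (m * d)%:R * (m + d)%:R ^+ 2 / (2 * (nu - 2) ^+ 2)) <=
  4 * (m * d)%:R `^ (3 / 2) / nu.
Proof.
move=> d0 m0 nu4 nuM.
wlog dm : d m d0 m0 nuM / (d <= m)%N.
  move=> wl; have /orP[dm|md] := leq_total d m; first exact: wl.
  by rewrite minnC (mulnC m) (addnC m); apply: wl => //; rewrite addnC.
rewrite (minn_idPl dm) mulnC.
have := @powR32_ge_sqr d m; rewrite d0 dm => /(_ isT).
set S := _ `^ _.
have d1 : 1 <= d%:R :> R by rewrite ler1n.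
have dmR : d%:R <= m%:R :> R by rewrite ler_nat.
move: nuM; rewrite !natrD natrM.
move: (d%:R : R) (m%:R : R) d1 dmR => k l k1 kl.
pose h := nu - 2; rewrite -/h => nuM kS.
have h0 : 0 < h by rewrite /h; lra.
have hM : 2 * (l + k) ^+ 2 <= h by rewrite /h; lra.
have S0 : 0 <= S by rewrite powR_ge0.
have k0 : 0 <= k by lra.
have l0 : 0 <= l by lra.
have kl0 : 0 <= k * l by rewrite mulr_ge0.
have klS : k * l <= S by apply: le_trans kS; rewrite expr2 -mulrA ler_peMl//.
have e1 : k * l * (l + k) ^+ 2 / (2 * h ^+ 2) <= S / (4 * h).
  rewrite ler_pdivrMr ?mulr_gt0 ?exprn_gt0//.
  rewrite (_ : S / (4 * h) * (2 * h ^+ 2) = S * (h / 2)); last by field; rewrite gt_eqF.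
  by rewrite ler_pM ?sqr_ge0//; lra.
(* 7 = 6 + 1: since 1 <= k <= l, (l + k + 1)(k + 1) <= 3 l * 2 k, and the extra l is at most k l. *)
have e2 : k * (l + k + 1) ^+ 2 - k * l * (l + k) <= 7 * S.
  apply: (@le_trans _ _ (7 * (k ^+ 2 * l))); last by rewrite ler_wpM2l.
  rewrite (_ : k * (l + k + 1) ^+ 2 - k * l * (l + k) =
    k * ((l + k + 1) * (k + 1) + l)); last by ring.
  rewrite (_ : 7 * (k ^+ 2 * l) = k * (7 * (k * l))); last by ring.
  rewrite ler_wpM2l//.
  have : (l + k + 1) * (k + 1) <= (3 * l) * (2 * k) by rewrite ler_pM//; lra.
  have : l <= k * l by rewrite ler_peMl.
  by lra.
have e3 : k * (l + k + 1) ^+ 2 / (4 * h) - k * l * (l + k) / (4 * h) <= 7 * S / (4 * h).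
  by rewrite -mulrBl ler_wpM2r// invr_ge0 mulr_ge0 ?(ltW h0).
(* The two errors add up to (7 + 1) S / (4 h). Since nu >= 4 gives nu <= 2 h, this is at most 4 S /
   nu. *)
apply: (@le_trans _ _ (2 * S / h)).
  have -> : 2 * S / h = 7 * S / (4 * h) + S / (4 * h) by field; rewrite gt_eqF.
  by lra.
rewrite ler_pdivrMr// mulrAC ler_pdivlMr; last by lra.
have : S * nu <= S * (2 * h) by rewrite ler_wpM2l// /h; lra.
by lra.
Qed.
End bound.

(** * The rescaled normal density against the t density *)

Section density.
Context {R : realType} {d m : nat}.
Variables (Sigma : 'M[R]_d) (Omega : 'M[R]_m).
Hypotheses (pSigma : posdefmx Sigma) (pOmega : posdefmx Omega).
Implicit Types (X : 'M[R]_(d, m)) (nu : R).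

Definition scaled_normal_density nu X : R :=
  let s := Num.sqrt (nu / (nu - 2)) in
  s ^- (d * m) * matrix_normal_density Sigma Omega (s^-1 *: X).

(** Puts the density over the denominator of [matrixT_density]: the power of (nu - 2) / 2 then faces
    the gamma ratio, and the exponential faces the determinant. *)
Lemma scaled_normal_densityE nu X : 2 < nu ->
  scaled_normal_density nu X =
  ((nu - 2) / 2) `^ ((m * d)%:R / 2) *
  expR (- ((nu - 2) / (2 * nu) * \tr (invmx Sigma *m X *m invmx Omega *m X^T))) /
  ((nu * pi) `^ ((m * d)%:R / 2) *
     \det Sigma `^ (m%:R / 2) * \det Omega `^ (d%:R / 2)).
Proof.
move=> nu2; rewrite /scaled_normal_density /matrix_normal_density.
have nu0 : 0 < nu by lra.
have h0 : 0 < nu - 2 by lra.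
have nh0 : 0 < nu / (nu - 2) by rewrite divr_gt0.
set h := nu - 2 in h0 nh0 *; set s := Num.sqrt _.
have sE : s ^- (d * m) = ((nu / h) `^ ((m * d)%:R / 2))^-1.
  rewrite /s -powR12_sqrt ?(ltW nh0)// -powR_mulrn ?powR_ge0// -powRrM mulnC.
  by rewrite (mulrC 2^-1).
have sV2 : s^-1 * s^-1 = h / nu.
  by rewrite -invfM -expr2 sqr_sqrtr ?(ltW nh0)// invf_div.
have -> : \tr (invmx Sigma *m (s^-1 *: X) *m invmx Omega *m (s^-1 *: X)^T) =
    h / nu * \tr (invmx Sigma *m X *m invmx Omega *m X^T).
  have -> : (s^-1 *: X)^T = s^-1 *: X^T by rewrite linearZ.
  by rewrite -!scalemxAr -!scalemxAl scalerA sV2 linearZ.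
have -> : (nu * pi) `^ ((m * d)%:R / 2) =
    (nu / h) `^ ((m * d)%:R / 2) * (2 * pi) `^ ((m * d)%:R / 2) *
    (h / 2) `^ ((m * d)%:R / 2).
  have pi0 := pi_gt0 R.
  rewrite -!powRM ?mulr_ge0 ?invr_ge0 ?(ltW nu0) ?(ltW h0) ?(ltW pi0)//.
  by congr (_ `^ _); field; rewrite gt_eqF.
rewrite sE.
have nz (x : R) : 0 < x -> x `^ ((m * d)%:R / 2) != 0 by move=> x0; rewrite gt_eqF ?powR_gt0.
have e10 := nz _ nh0; have e20 := nz _ (mulr_gt0 (ltr0Sn R 1) (pi_gt0 R)).
have e30 := nz _ (divr_gt0 h0 (ltr0Sn R 1)).
have D10 : \det Sigma `^ (m%:R / 2) != 0 by rewrite gt_eqF ?powR_gt0 ?posdefmx_det_gt0.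
have D20 : \det Omega `^ (d%:R / 2) != 0 by rewrite gt_eqF ?powR_gt0 ?posdefmx_det_gt0.
set T := \tr _.
rewrite (_ : 2^-1 * (h / nu * T) = h / (2 * nu) * T); last by field; rewrite gt_eqF.
by field; rewrite e10 e20 e30 D10 D20.
Qed.

Lemma scaled_normal_density_le nu X : (0 < d)%N -> (0 < m)%N ->
  4 < nu -> 2 + 2 * (m + d)%:R ^+ 2 <= nu ->
  scaled_normal_density nu X <=
  expR (4 * (m * d)%:R `^ (3 / 2) / nu) * matrixT_density nu Sigma Omega X.
Proof.
move=> d0 m0 nu4 nuM.
have nu2 : 2 < nu by lra.
have h0 : 0 < nu - 2 by lra.
rewrite scaled_normal_densityE// /matrixT_density.
set D := (_ * _ * _)%R; set E := expR (4 * _ / _).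
rewrite [X in E * X]mulrA [leRHS]mulrA ler_wpM2r//.
  by rewrite invr_ge0 !mulr_ge0 ?powR_ge0.
(* The smaller dimension gives the smaller error k M^2 / (4 h), as [exponent_le] requires. *)
have kdm : (minn d m == d) || (minn d m == m).
  by rewrite /minn; case: ifP; rewrite eqxx ?orbT.
have detle := det_kernel_powR_ge pSigma pOmega X kdm nu2.
have gle := le_trans (prod_sqrt_ge d m h0) (mgamma_fun_ratio_ge d m nu4).
have expo := exponent_le d0 m0 (ltW nu4) nuM.
apply: le_trans (ler_wpM2l (expR_ge0 _) (ler_pM _ _ gle detle)); last 2 first.
- by rewrite mulr_ge0 ?powR_ge0 ?expR_ge0.
- exact: expR_ge0.
rewrite -[X in E * X]mulrA [leRHS]mulrCA ler_wpM2l ?powR_ge0// -!expRD ler_expR.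
by lra.
Qed.

End density.

(** * Probability metrics *)

Section metrics.
Context {R : realType} {d m : nat}.
Local Notation M := 'M[R]_(d, m).
Implicit Types (P Q : probability M R) (x y z : M).

Lemma measurable_orthant x :
  measurable [set y : M | forall i j, y i j <= x i j].
Proof.
rewrite (_ : mkset _ = \bigcap_(ij in [set: 'I_d * 'I_m])
    ((fun y : M => y ij.1 ij.2) @^-1` [set` `]-oo, x ij.1 ij.2]])).
  apply: fin_bigcap_measurable => //= -[i j] _.
  by rewrite -[X in measurable X]setTI; apply: measurable_coord.
apply/seteqP; split=> [y yx [i j] _|y yx i j] /=.
  by rewrite in_itv/=.
by have := yx (i, j) I; rewrite /= in_itv.
Qed.

Lemma norm2_mx_ge0 x : 0 <= norm2_mx x.
Proof. exact: sqrtr_ge0. Qed.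

Lemma sqr_norm2_mx x : norm2_mx x ^+ 2 = \sum_(i < d) \sum_(j < m) x i j ^+ 2.
Proof.
by rewrite sqr_sqrtr// !sumr_ge0// => i _; rewrite sumr_ge0// => j _; exact: sqr_ge0.
Qed.

(** A weighted substitute for the triangle inequality, holding entrywise: the difference of the two
    sides is (t x - y)^2 / t. *)
Lemma sqr_norm2_mxD_le x y (t : R) : 0 < t ->
  norm2_mx (x + y) ^+ 2 <=
  (1 + t) * norm2_mx x ^+ 2 + (1 + t^-1) * norm2_mx y ^+ 2.
Proof.
move=> t0; rewrite !sqr_norm2_mx !mulr_sumr -big_split /=.
apply: ler_sum => i _; rewrite !mulr_sumr -big_split /=.
apply: ler_sum => j _; rewrite mxE -subr_ge0.
rewrite (_ : _ - _ = t^-1 * (t * x i j - y i j) ^+ 2); last by field; rewrite gt_eqF.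
by rewrite mulr_ge0 ?sqr_ge0// invr_ge0 ltW.
Qed.

Lemma sqr_norm2_mx_le x (e : R) : (forall i j, `|x i j| <= e) ->
  norm2_mx x ^+ 2 <= (d * m)%:R * e ^+ 2.
Proof.
move=> xe; rewrite sqr_norm2_mx.
have -> : (d * m)%:R * e ^+ 2 = \sum_(i < d) \sum_(j < m) e ^+ 2.
  by rewrite !sumr_const !card_ord -mulrnA -[RHS]mulr_natl mulnC.
apply: ler_sum => i _; apply: ler_sum => j _.
by rewrite -[leLHS]real_normK ?num_real// lerXn2r ?nnegrE// (le_trans _ (xe i j)).
Qed.

(** Euclidean distance to [A] is continuous for the max-norm topology that generates the Borel sets.
    In explicit form: if [x] is at distance at least r > e, a max-norm ball around [x] stays at
    distance at least rho, the midpoint of e and r. *)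
Lemma open_enlargeC (A : set M) (e : R) : 0 <= e -> open (~` enlarge A e).
Proof.
move=> e0; rewrite openE => x /= /negP; rewrite -ltNge => einf.
have [r [er rA]] : exists r, e < r /\ forall y, A y -> r <= norm2_mx (x - y).
  have infA y : A y ->
      (ereal_inf [set (norm2_mx (x - z))%:E | z in A] <= (norm2_mx (x - y))%:E)%E.
    by move=> Ay; apply: ereal_inf_lbound; exists y.
  case: (ereal_inf _) einf infA => [r| |//].
    rewrite lte_fin => er infA; by exists r; split.
  move=> _ infA; exists (e + 1); split=> [|y Ay]; first by rewrite ltrDl.
  by have := infA _ Ay; rewrite leye_eq.
pose rho := (e + r) / 2; pose g := r ^+ 2 - rho ^+ 2.
have rho0 : 0 < rho by rewrite /rho; lra.
have erho : e < rho by rewrite /rho; lra.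
have rhor : rho < r by rewrite /rho; lra.
have g0 : 0 < g.
  by rewrite /g subr_gt0 ltr_pXn2r ?nnegrE ?(ltW rho0)// ltW// (lt_trans rho0).
(* Chosen so that (1 + t) rho^2 = rho^2 + g / 2, which spends half of the gap g = r^2 - rho^2. *)
pose t := g / (2 * rho ^+ 2).
have t0 : 0 < t by rewrite /t divr_gt0// mulr_gt0// exprn_gt0.
have t1 : 0 < 1 + t^-1 by rewrite addr_gt0 ?invr_gt0.
have tE : t * (2 * rho ^+ 2) = g by rewrite divfK// gt_eqF// mulr_gt0// exprn_gt0.
clearbody t.
pose N : R := (d * m).+1%:R.
have N0 : 0 < N by rewrite ltr0n.
have Ndm : (d * m)%:R <= N by rewrite ler_nat.
clearbody N.
(* The other half of the gap pays for the move from x to z. The minimum with 1 gives eta^2 <= eta,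
   and N is a successor so that it is positive even when d m = 0. *)
pose eta := Num.min 1 (g / (2 * (N * (1 + t^-1)))).
have eta0 : 0 < eta by rewrite /eta lt_min ltr01 divr_gt0// !mulr_gt0.
have etag : (1 + t^-1) * (N * eta ^+ 2) <= g / 2.
  have : eta ^+ 2 <= g / (2 * (N * (1 + t^-1))).
    apply: (@le_trans _ _ eta); last by rewrite ge_min lexx orbT.
    by rewrite expr2 ler_piMl ?(ltW eta0)// ge_min lexx.
  rewrite ler_pdivlMr ?mulr_gt0// => h.
  rewrite [leLHS](_ : _ = eta ^+ 2 * (2 * (N * (1 + t^-1))) / 2); last first.
    by field; rewrite gt_eqF.
  by rewrite ler_wpM2r.
apply/nbhs_ballP; exists eta => //= z xz /=.
apply/negP; rewrite -ltNge; apply: (@lt_le_trans _ _ rho%:E); first by rewrite lte_fin.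
apply: le_ereal_inf_tmp => _ [y Ay <-]; rewrite lee_fin leNgt; apply/negP => zy.
have xzle : norm2_mx (x - z) ^+ 2 <= N * eta ^+ 2.
  apply: (@le_trans _ _ ((d * m)%:R * eta ^+ 2)).
    apply: sqr_norm2_mx_le => i j; case: xz => _ /(_ i j).
    by rewrite -ball_normE /= !mxE => /ltW.
  by rewrite ler_wpM2r ?sqr_ge0.
have := sqr_norm2_mxD_le (z - y) (x - z) t0.
rewrite addrC subrKA.
have rle : r ^+ 2 <= norm2_mx (x - y) ^+ 2.
  by rewrite lerXn2r ?nnegrE ?norm2_mx_ge0 ?rA//; lra.
have zyle : norm2_mx (z - y) ^+ 2 < rho ^+ 2.
  by rewrite ltr_pXn2r ?nnegrE ?norm2_mx_ge0// ltW.
have : (1 + t) * norm2_mx (z - y) ^+ 2 < (1 + t) * rho ^+ 2.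
  by rewrite ltr_pM2l// addr_gt0.
have : (1 + t^-1) * norm2_mx (x - z) ^+ 2 <= (1 + t^-1) * (N * eta ^+ 2).
  by rewrite ler_wpM2l// ltW.
have -> : (1 + t) * rho ^+ 2 = rho ^+ 2 + g / 2.
  by rewrite -tE; field.
by move: etag rle; rewrite /g; lra.
Qed.

Lemma measurable_enlarge (A : set M) (e : R) : 0 <= e -> measurable (enlarge A e).
Proof.
move=> e0; rewrite -[enlarge A e]setCK; apply: measurableC.
by apply: sub_sigma_algebra; exact: open_enlargeC.
Qed.

Lemma subset_enlarge (A : set M) (e : R) : 0 <= e -> A `<=` enlarge A e.
Proof.
move=> e0 x Ax; apply: ge_ereal_inf; exists (norm2_mx (x - x))%:E; first by exists x.
rewrite lee_fin subrr /norm2_mx big1 ?sqrtr0// => i _.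
by rewrite big1// => j _; rewrite mxE expr0n.
Qed.

(** A closed ball is the enlargement of a singleton. *)
Lemma measurable_closed_ball2 x (r : R) : 0 < r -> measurable (closed_ball2 x r).
Proof.
move=> r0; rewrite (_ : closed_ball2 x r = enlarge [set x] r).
  by apply: measurable_enlarge; exact: ltW.
by apply/seteqP; split=> y; rewrite /enlarge /closed_ball2 /= image_set1 ereal_inf1 lee_fin.
Qed.

(** * Metrics controlled by total variation *)

Section tv_bound.
Variables (P Q : probability M R) (b : R).
Hypothesis b0 : 0 < b.
Hypothesis PQ : forall A, measurable A -> (`|P A - Q A| <= b%:E)%E.

Let le_Db A : measurable A -> (P A <= Q A + b%:E)%E /\ (Q A <= P A + b%:E)%E.
Proof.
move=> mA; have := PQ mA.
rewrite -(fineK (fin_num_measure P A mA)) -(fineK (fin_num_measure Q A mA)).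
rewrite -EFinB abse_EFin -!EFinD !lee_fin ler_distl => /andP[? ?]; split; lra.
Qed.

Lemma total_variation_dist_le : (total_variation_dist P Q <= b%:E)%E.
Proof. by apply: ge_ereal_sup => _ [A mA <-]; exact: PQ. Qed.

Lemma kolmogorov_dist_le : (kolmogorov_dist P Q <= b%:E)%E.
Proof.
by apply: ge_ereal_sup => _ [x _ <-]; apply: PQ; exact: measurable_orthant.
Qed.

Lemma discrepancy_dist_le : (discrepancy_dist P Q <= b%:E)%E.
Proof.
apply: ge_ereal_sup => _ [_ [x [r [r0 ->]]] <-]; apply: PQ.
exact: measurable_closed_ball2.
Qed.

(** [b] itself is an admissible epsilon, since shifting the argument only helps a monotone
    distribution function. *)
Lemma levy_dist_le : (levy_dist P Q <= b%:E)%E.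
Proof.
apply: ereal_inf_lbound; exists b => //; split=> // x.
have mono x1 x2 : (forall i j, x1 i j <= x2 i j) -> (cdf_mx P x1 <= cdf_mx P x2)%E.
  move=> x12; apply: le_measure; rewrite ?inE; try exact: measurable_orthant.
  by move=> y yx i j; exact: le_trans (yx i j) (x12 i j).
have [PQx QPx] := le_Db (measurable_orthant x); split.
  rewrite leeBlDr//; apply: le_trans PQx; apply: mono => i j.
  by rewrite !mxE gerBl ltW.
apply: (le_trans QPx); rewrite leeD2r//; apply: mono => i j.
by rewrite !mxE lerDl ltW.
Qed.

Lemma prokhorov_dist_le : (prokhorov_dist P Q <= b%:E)%E.
Proof.
apply: ereal_inf_lbound; exists b => //; split=> // A mA.
apply: (le_trans (le_Db mA).1); rewrite leeD2r// le_measure ?inE//.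
  by apply: measurable_enlarge; exact: ltW.
by apply: subset_enlarge; exact: ltW.
Qed.

(** (sqrt p - sqrt q)^2 <= |p - q|. The set where q <= p and its complement each contribute at most
    [b] to the integral. *)
Lemma hellinger_dist_le (p q : M -> R) : has_density P p -> has_density Q q ->
  (hellinger_dist p q <= (Num.sqrt (2 * b))%:E)%E.
Proof.
move=> [mp p0 pE] [mq q0 qE].
have ip (r : M -> R) (S : probability M R) A : measurable A ->
    measurable_fun setT r -> (forall x, 0 <= r x) ->
    (forall A, measurable A -> S A = \int[@lebesgue_mx R d m]_(x in A) (r x)%:E)%E ->
    (@lebesgue_mx R d m).-integrable A (EFin \o r).
  move=> mA mr r0 rE; apply/integrableP; split.
    by apply/measurable_EFinP; exact: measurable_funTS.
  under eq_integral do rewrite /= ger0_norm//.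
  by rewrite -rE// ltey_eq fin_num_measure.
pose f x := ((Num.sqrt (p x) - Num.sqrt (q x)) ^+ 2)%R.
have msqrt : measurable_fun setT (@Num.sqrt R).
  by apply: continuous_measurable_fun; exact: sqrt_continuous.
have mf : measurable_fun setT f.
  by apply: measurable_funX; apply: measurable_funB; exact: (measurableT_comp msqrt).
pose E := [set x | q x <= p x].
have mE : measurable E.
  by rewrite -[E]setTI; exact: measurable_fun_le.
(* Stated for a generic pair with s <= r on [A], to serve both halves with the roles of p and q
   exchanged. Pointwise, (u - v)^2 <= u^2 - v^2 when 0 <= v <= u. *)
have half (r s : M -> R) (S T : probability M R) A : measurable A ->
    has_density S r -> has_density T s -> (S A <= T A + b%:E)%E ->
    (forall x, A x -> s x <= r x) ->
    (forall x, f x = (Num.sqrt (r x) - Num.sqrt (s x)) ^+ 2) ->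
    (\int[@lebesgue_mx R d m]_(x in A) (f x)%:E <= b%:E)%E.
  move=> mA [mr r0 rE] [ms s0 sE] ST sr fE.
  have ir := ip r S A mA mr r0 rE; have is_ := ip s T A mA ms s0 sE.
  apply: (@le_trans _ _ (\int[@lebesgue_mx R d m]_(x in A) ((r x)%:E - (s x)%:E))%E).
    apply: ge0_le_integral => //.
    - by move=> x _; rewrite lee_fin sqr_ge0.
    - by apply/measurable_EFinP; exact: measurable_funTS.
    - apply: emeasurable_funB; apply/measurable_EFinP; exact: measurable_funTS.
    move=> x Ax; rewrite -EFinB lee_fin fE.
    have h1 := sqr_sqrtr (r0 x); have h2 := sqr_sqrtr (s0 x).
    have : Num.sqrt (s x) <= Num.sqrt (r x) by rewrite ler_wsqrtr// sr.
    have := sqrtr_ge0 (s x).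
    move: h1 h2; set u := Num.sqrt (r x); set v := Num.sqrt (s x) => <- <- v0 uv.
    nra.
  rewrite integralB_EFin// -rE// -sE// leeBlDr ?fin_num_measure//.
  by rewrite addeC.
have fle : (\int[@lebesgue_mx R d m]_x (f x)%:E <= (2 * b)%:E)%E.
  rewrite -(setUv E) ge0_integral_setU//; last 4 first.
  - exact: measurableC.
  - by rewrite setUv; apply/measurable_EFinP.
  - by move=> x _; rewrite lee_fin sqr_ge0.
  - exact/disj_setPCl.
  rewrite (_ : 2 * b = b + b); last by ring.
  rewrite EFinD leeD//.
    by apply: (half p q P Q) => //; exact: (le_Db mE).1.
  apply: (half q p Q P) => //.
  - exact: measurableC.
  - exact: (le_Db (measurableC mE)).2.
  - by move=> x /negP; rewrite -ltNge => /ltW.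
  - by move=> x; rewrite /f -sqrrN opprB.
rewrite /hellinger_dist -powR12_sqrt; last by rewrite mulr_ge0// ltW.
rewrite -poweR_EFin gt0_ler_poweR// ?in_itv /= ?leey ?andbT//.
  by apply: integral_ge0 => x _; rewrite lee_fin sqr_ge0.
by rewrite lee_fin mulr_ge0// ltW.
Qed.

End tv_bound.

(** Domination gives Q B - P B <= e P B <= e. Taking B to be [A] and then its complement bounds both
    signs. *)
Lemma dominated_dist_le P Q (e : R) : 0 <= e ->
  (forall A, measurable A -> (Q A <= (1 + e)%:E * P A)%E) ->
  forall A, measurable A -> (`|P A - Q A| <= e%:E)%E.
Proof.
move=> e0 dom A mA.
have side B : measurable B -> fine (Q B) - fine (P B) <= e.
  move=> mB; have := dom _ mB; have := probability_le1 P mB.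
  rewrite -{1 2}(fineK (fin_num_measure P B mB)) -{1}(fineK (fin_num_measure Q B mB)).
  by rewrite -EFinM !lee_fin => ? ?; nra.
have := side _ mA; have := side _ (measurableC mA).
rewrite !probability_setC// !fineB ?fin_num_measure//=.
move: (fineK (fin_num_measure P A mA)) (fineK (fin_num_measure Q A mA)).
move: (fine (P A)) (fine (Q A)) => u v <- <-.
by rewrite -EFinB abse_EFin lee_fin ler_norml => ? ?; apply/andP; split; lra.
Qed.
End metrics.

(** * The law of the rescaled normal matrix and the conclusion *)

Lemma has_density_scale_mx (R : realType) (d m : nat) (dT : measure_display)
    (T : measurableType dT) (P : probability T R) (Y : {RV P >-> 'M[R]_(d, m)})
    (Sigma : 'M[R]_d) (Omega : 'M[R]_m) (nu : R) : 2 < nu ->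
  has_density (distribution P Y) (matrix_normal_density Sigma Omega) ->
  has_density (distribution P (scale_mx (Num.sqrt (nu / (nu - 2))) Y))
    (scaled_normal_density Sigma Omega nu).
Proof.
move=> nu2 [mg g0 gE].
have s0 : 0 < Num.sqrt (nu / (nu - 2)) by rewrite sqrtr_gt0 divr_gt0; lra.
rewrite /scaled_normal_density; move: (Num.sqrt _) s0 => s s0.
have mgs : measurable_fun setT (fun x : 'M[R]_(d, m) => matrix_normal_density Sigma Omega (s^-1 *: x)).
  exact: (measurableT_comp mg (measurable_scalemx s^-1)).
have sn0 : 0 <= s ^- (d * m) by rewrite invr_ge0 exprn_ge0// ltW.
split=> [|x|A mA]; first exact: measurable_funM.
  by rewrite mulr_ge0.
transitivity (distribution P Y ( *:%R s @^-1` A)); first by [].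
rewrite gE; last by rewrite -[X in measurable X]setTI; apply: measurable_scalemx.
have := @ge0_integral_mx_dilation R d m s A
  (fun x => (matrix_normal_density Sigma Omega (s^-1 *: x))%:E) s0 mA.
move=> dil.
(* Writing x as s^-1 (s x) exhibits the integrand as a function of s x, ready for the dilation
   formula. *)
under eq_integral do rewrite -[X in matrix_normal_density _ _ X](scalerK (lt0r_neq0 s0)).
rewrite dil; last 2 first.
- by apply/measurable_EFinP; exact: measurable_funTS.
- by move=> x _; rewrite lee_fin.
rewrite -ge0_integralZl//.
- by apply/measurable_EFinP; exact: measurable_funTS.
- by move=> x _; rewrite lee_fin.
Qed.

(** exp(x) (1 - x) <= 1, while (1 + 2 x)(1 - x) >= 1 on this range. *)
Lemma expR_le1D2 (R : realType) (x : R) : 0 <= x -> x <= 2^-1 -> expR x <= 1 + 2 * x.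
Proof.
move=> x0 x1.
have : expR x * expR (- x) = 1 by rewrite -expRD subrr expR0.
have := expR_ge1Dx (- x); have := expR_gt0 x; nra.
Qed.

Theorem theorem2 (R : realType) :
  exists C : R, 0 < C /\
  forall (d m : nat) (Sigma : 'M[R]_d) (Omega : 'M[R]_m),
    (0 < d)%N -> (0 < m)%N -> posdefmx Sigma -> posdefmx Omega ->
  \forall nu \near +oo,
  forall (d1 d2 : measure_display)
    (T1 : measurableType d1) (T2 : measurableType d2)
    (P1 : probability T1 R) (P2 : probability T2 R)
    (X : {RV P1 >-> 'M[R]_(d, m)}) (Y : {RV P2 >-> 'M[R]_(d, m)}),
    has_density (distribution P1 X) (matrixT_density nu Sigma Omega) ->
    has_density (distribution P2 Y) (matrix_normal_density Sigma Omega) ->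
  let P : probability 'M[R]_(d, m) R := distribution P1 X in
  let Q : probability 'M[R]_(d, m) R :=
    distribution P2 (scale_mx (Num.sqrt (nu / (nu - 2))) Y) in
  let b := C * (m * d)%:R `^ (3 / 2) / nu in
  [/\ (total_variation_dist P Q <= b%:E)%E,
      (kolmogorov_dist P Q <= b%:E)%E,
      (levy_dist P Q <= b%:E)%E,
      (discrepancy_dist P Q <= b%:E)%E &
      (prokhorov_dist P Q <= b%:E)%E] /\
  forall p q : 'M[R]_(d, m) -> R, has_density P p -> has_density Q q ->
    (hellinger_dist p q <= (Num.sqrt (2 * C * (m * d)%:R `^ (3 / 2) / nu))%:E)%E.
Proof.
(* 8 is twice the 4 of [exponent_le]; the doubling comes from [expR_le1D2]. *)
exists 8; split=> // d m Sigma Omega d0 m0 pSigma pOmega.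
set S := (m * d)%:R `^ (3 / 2).
have S0 : 0 < S by rewrite powR_gt0// ltr0n muln_gt0 m0.
near=> nu => d1 d2 T1 T2 P1 P2 X Y dX dY.
pose P : probability 'M[R]_(d, m) R := distribution P1 X.
pose Q : probability 'M[R]_(d, m) R :=
  distribution P2 (scale_mx (Num.sqrt (nu / (nu - 2))) Y).
pose b := 8 * S / nu.
(* Three thresholds: [nu4] keeps the gamma arguments in range, [nuM] absorbs the second-order error,
   and [nuS] brings the exponent 4 S / nu down to 1/2. *)
have nu4 : 4 < nu by near: nu; apply: nbhs_pinfty_gt; exact: num_real.
have nuM : 2 + 2 * (m + d)%:R ^+ 2 <= nu by near: nu; apply: nbhs_pinfty_ge; exact: num_real.
have nuS : 8 * S <= nu by near: nu; apply: nbhs_pinfty_ge; exact: num_real.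
have nu0 : 0 < nu by lra.
have b0 : 0 < b by rewrite /b divr_gt0// mulr_gt0.
have dQ : has_density Q (scaled_normal_density Sigma Omega nu).
  by apply: has_density_scale_mx => //; lra.
have dom A : measurable A -> (Q A <= (1 + b)%:E * P A)%E.
  move=> mA; case: dX dQ => [mp p0 pE] [mq q0 qE]; rewrite [P A]pE// [Q A]qE//.
  rewrite -ge0_integralZl//.
  - apply: ge0_le_integral => //.
    + by move=> x _; rewrite lee_fin.
    + by apply/measurable_EFinP; exact: measurable_funTS.
    + apply: measurable_funeM; apply/measurable_EFinP; exact: measurable_funTS.
    move=> x _; rewrite -EFinM lee_fin.
    apply: (le_trans (scaled_normal_density_le pSigma pOmega x d0 m0 nu4 nuM)).
    apply: ler_wpM2r => //.
    have -> : b = 2 * (4 * S / nu) by rewrite /b; field; rewrite gt_eqF.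
    apply: expR_le1D2; first by rewrite divr_ge0 ?mulr_ge0 ?ltW.
    by rewrite ler_pdivrMr// -/S; lra.
  - by apply/measurable_EFinP; exact: measurable_funTS.
  - by move=> x _; rewrite lee_fin.
  - by rewrite lee_fin addr_ge0 ?(ltW b0).
have PQ := dominated_dist_le (ltW b0) dom.
split=> [|p q dp dq].
  split.
  - exact: total_variation_dist_le.
  - exact: kolmogorov_dist_le.
  - exact: levy_dist_le.
  - exact: discrepancy_dist_le.
  - exact: prokhorov_dist_le.
rewrite (_ : 2 * 8 * S / nu = 2 * b); last by rewrite /b; field; rewrite gt_eqF.
exact: hellinger_dist_le dp dq.
Unshelve. all: by end_near. Qed.
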